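(* Suppose that the density $f_E(t,y)$ of the inverse subordinator $E(t)$ exists and, additionally, that $\mathbb{E}[E(t)^{-H}]<+\infty$ for any $t>0$. Then the probability density function $p_H^\Psi(t,x)$ of $U_H^\Psi(t)$ exists for all $t>0$ and satisfies $$p_H^\Psi(t,x)=\int_0^{+\infty}p_H(y,x)f_E(t,y)\,dy.$$
   Context: Fix $H\in(\frac12,1)$ and $\theta>0$. On a complete probability space let $B^H=\{B^H(t),t\ge0\}$ be a fractional Brownian motion, i.e. a centered Gaussian process with $\mathbb{E}[B^H(t)B^H(s)]=\frac12(t^{2H}+s^{2H}-|t-s|^{2H})$. The fractional Ornstein-Uhlenbeck (fOU) process is $U_H(t)=e^{-t/\theta}\int_0^t e^{s/\theta}\,dB^H(s)$, $t\ge0$ (Wiener integral); it is a centered Gaussian process with variance $$V_{2,H}(t)=H(2H-1)\theta^{2H}\int_0^{t/\theta}\int_0^{t/\theta}e^{-s-u}|u-s|^{2H-2}\,du\,ds.$$ Its density is $p_H(t,x)=\frac{1}{\sqrt{2\pi V_{2,H}(t)}}e^{-x^2/(2V_{2,H}(t))}$, $t>0$, $x\in\mathbb{R}$. Let $\sigma=\{\sigma(y),y\ge0\}$ be a driftless subordinator with Lévy measure $\nu$ on $(0,+\infty)$, $\int_0^{+\infty}(1\wedge x)\nu(dx)<+\infty$, $\nu(0,+\infty)=+\infty$, so $\mathbb{E}[e^{-\lambda\sigma(y)}]=e^{-y\Psi(\lambda)}$ with $\Psi(\lambda)=\int_0^{+\infty}(1-e^{-\lambda x})\nu(dx)$. The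 inverse subordinator is $E(t)=\inf\{y>0:\sigma(y)>t\}$, assumed independent of $U_H$; $f_E(t,\cdot)$ denotes the probability density function of $E(t)$, $t>0$. The time-changed fOU process is $U_H^\Psi(t)=U_H(E(t))$. *)

(* Defs.v *)
From HB Require Import structures.
From mathcomp Require Export all_boot all_order all_algebra.
From mathcomp Require Export all_classical all_reals all_analysis.

Set Implicit Arguments.
Unset Strict Implicit.
Unset Printing Implicit Defensive.

Import Order.TTheory GRing.Theory Num.Theory.
Import numFieldNormedType.Exports.

Local Open Scope classical_set_scope.
Local Open Scope ring_scope.

(* Stochastic processes indexed by [0, +oo[ are functions R -> T -> R whose
   values at negative times are never used. *)

Section random_variables.
Context (d : measure_display) (T : measurableType d) (R : realType).
Variable P : probability T R.
Implicit Types (X : T -> R) (B : R -> T -> R).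

Definition has_density X (p : R -> R) : Prop :=
  [/\ measurable_fun [set: T] X,
      measurable_fun [set: R] p,
      forall x, 0 <= p x &
      forall A : set R, measurable A ->
        P (X @^-1` A) = (\int[lebesgue_measure]_(x in A) (p x)%:E)%E].

(* Gaussian laws include the Dirac masses, which [normal_prob m 0] is not. *)
Definition is_gaussian X : Prop :=
  measurable_fun [set: T] X /\
  exists m s : R, forall A : set R, measurable A ->
    P (X @^-1` A) = if s == 0 then \d_m A else normal_prob m s A.

(* A list of pairs (c, r) encodes the step function which is the sum of the
   c * 1_[0, r]; [step_int] is its elementary integral, the sum of the
   c * B(r). *)
Definition step_fun (s : seq (R * R)) (u : R) : R :=
  \sum_(a <- s) a.1 * \1_(`[0, a.2]%classic) u.

Definition step_int B (s : seq (R * R)) (w : T) : R :=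
  \sum_(a <- s) a.1 * B a.2 w.

Definition gaussian_process B : Prop :=
  forall s : seq (R * R), all (fun a => 0 <= a.2) s ->
    is_gaussian (step_int B s).

Record is_fBm (H : R) B : Prop := IsFBm {
  fBm_gaussian : gaussian_process B;
  fBm_centered : forall t : R, 0 <= t -> 'E_P[B t]%E = 0%E;
  fBm_cov : forall s t : R, 0 <= s -> 0 <= t ->
    'E_P[fun w => (B t w * B s w)%R]%E =
    ((t `^ (2 * H) + s `^ (2 * H) - `|t - s| `^ (2 * H)) / 2)%:E }.

(* The squared norm of f in the space |H| of integrands on [0, t]. It dominates
   the squared norm of f in the reproducing kernel Hilbert space of B (the
   latter has f u * f v in place of `|f u| * `|f v|). *)
Definition abs_norm2 (H t : R) (f : R -> R) : \bar R :=
  ((H * (2 * H - 1))%:E *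
   \int[lebesgue_measure]_(u in `[0%R, t])
     \int[lebesgue_measure]_(v in `[0%R, t])
       (`|f u| * `|f v| * `|u - v| `^ (2 * H - 2))%R%:E)%E.

(* X is (a version of) the Wiener integral of f on [0, t]: the extension by
   continuity of the isometry 1_[0, r] |-> B(r) into L^2(P). *)
Definition is_wiener_integral (H : R) B (t : R) (f : R -> R) X : Prop :=
  measurable_fun [set: T] X /\
  exists s : nat -> seq (R * R),
    [/\ forall n, all (fun a => 0 <= a.2 <= t) (s n),
        abs_norm2 H t (fun u => step_fun (s n) u - f u) @[n --> \oo] --> 0%E &
        'E_P[fun w => ((step_int B (s n) w - X w) ^+ 2)%R]%E @[n --> \oo] --> 0%E].

(* The Wiener integral fixes U t only up to a null set for each t; the version
   with continuous paths is chosen, so that U can be evaluated at a random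
   time. *)
Record is_fOU (H theta : R) B (U : R -> T -> R) : Prop := IsFOU {
  fOU_wiener : forall t : R, 0 <= t -> exists2 I : T -> R,
    is_wiener_integral H B t (fun s => expR (s / theta)) I &
    forall w, U t w = expR (- (t / theta)) * I w;
  fOU_continuous : {ae P, forall w,
    {within `[0, +oo[, continuous (fun t => U t w)}} }.

Definition process_sigma (X : R -> T -> R) : set (set T) :=
  <<s [set S | exists (t : R) (A : set R),
         [/\ 0 <= t, measurable A & S = X t @^-1` A]] >>.

Definition independent_processes (X Y : R -> T -> R) : Prop :=
  forall A C, process_sigma X A -> process_sigma Y C ->
    P (A `&` C) = (P A * P C)%E.

End random_variables.

Section subordinators.
Context (R : realType).

Record is_levy_measure (nu : {measure set (measurableTypeR R) -> \bar R}) :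
    Prop := IsLevyMeasure {
  levy_support : nu `]-oo, 0%R]%classic = 0%E;
  levy_integrable :
    (\int[nu]_(x in `]0%R, +oo[) (Num.min 1 x)%:E < +oo)%E;
  levy_infinite : nu `]0%R, +oo[%classic = +oo%E }.

Definition laplace_exponent
    (nu : {measure set (measurableTypeR R) -> \bar R}) (lambda : R) : R :=
  \int[nu]_(x in `]0%R, +oo[) (1 - expR (- (lambda * x))).

Context (d : measure_display) (T : measurableType d).
Variable P : probability T R.
Implicit Types sigma : R -> T -> R.

Definition increment sigma (s t : R) (w : T) : R := sigma t w - sigma s w.

Record is_subordinator (nu : {measure set (measurableTypeR R) -> \bar R})
    sigma : Prop := IsSubordinator {
  sub_measurable : forall y : R, 0 <= y -> measurable_fun [set: T] (sigma y);
  sub_zero : {ae P, forall w, sigma 0 w = 0};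
  sub_indep : forall (n : nat) (y : nat -> R) (A : nat -> set R),
    0 <= y 0 -> (forall i, y i <= y i.+1) -> (forall i, measurable (A i)) ->
    P (\big[setI/setT]_(i < n)
         increment sigma (y i) (y i.+1) @^-1` A i) =
    (\prod_(i < n) P (increment sigma (y i) (y i.+1) @^-1` A i))%E;
  sub_stationary : forall (s h : R) (A : set R),
    0 <= s -> 0 <= h -> measurable A ->
    P (increment sigma s (s + h) @^-1` A) = P (sigma h @^-1` A);
  sub_nondecreasing : {ae P, forall w, forall x y : R, 0 <= x -> x <= y ->
    sigma x w <= sigma y w};
  sub_right_continuous : {ae P, forall w, forall y : R, 0 <= y ->
    sigma z w @[z --> y^'+] --> sigma y w};
  sub_laplace : forall y lambda : R, 0 <= y -> 0 <= lambda ->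
    'E_P[fun w => expR (- (lambda * sigma y w))%R]%E =
    (expR (- (y * laplace_exponent nu lambda)))%:E }.

(* [inf] is real-valued, with inf set0 = 0; when nu has infinite mass the paths
   of sigma are almost surely unbounded and the set is not empty. *)
Definition inverse_subordinator sigma (t : R) (w : T) : R :=
  inf [set y | 0 < y /\ t < sigma y w].

Definition time_change (U E : R -> T -> R) (t : R) (w : T) : R := U (E t w) w.

End subordinators.

Section fOU_density.
Context (R : realType).
Implicit Types H theta t x : R.

Definition fOU_var H theta t : R :=
  H * (2 * H - 1) * theta `^ (2 * H) *
  \int[lebesgue_measure]_(s in `[0%R, t / theta])
    \int[lebesgue_measure]_(u in `[0%R, t / theta])
      (expR (- s - u) * `|u - s| `^ (2 * H - 2)).

Definition fOU_pdf H theta t x : R :=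
  (Num.sqrt (2 * pi * fOU_var H theta t))^-1 *
  expR (- (x ^+ 2 / (2 * fOU_var H theta t))).

End fOU_density.

(* Main.v *)
(* Each U(y), y > 0, is an L^2 limit of centered Gaussian elementary integrals.
   Their variances are the quadratic form of the kernel H(2H-1)|u - v|^(2H-2)
   at step functions; the convergence of the integrands in |H| controls both
   this form and the L^1 distance, so the variances converge and U(y) is
   N(0, V(y)).  Let phi be Lipschitz with values in [0, 1] and let
   G(y) = E[phi(U(y))].  Rounding E(t) down to the grid Z/n, independence gives
   E[phi(U(E_n))] = E[G(E_n)], and path continuity lets n tend to infinity:
   E[phi(U(E(t)))] = E[G(E(t))].  By Tonelli the right-hand side is the integral
   of phi against the mixture of the Gaussian densities.  The mixture is finite
   because V(y)^(-1/2) <= C (y^(-H) + 1), and Lipschitz ramps approximating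
   the indicators of the rays ]a, +oo[ show that it is the density. *)

(* Convergence of step functions to an integrand f in |H| only says that the form of the absolute
   error tends to 0; expanding the form around f also yields cross terms, linear in the error. On
   [[0, t]^2] the kernel is at least t^(2H-2) off the diagonal, so the form dominates the square of
   the L^1 norm; as f is bounded and the kernel has bounded integrals in one variable, the L^1 norm
   in turn bounds the cross terms. Lipschitz test functions with values in [0, 1] pass to the limit
   along L^2 convergence by an elementary inequality and along continuous paths by domination, and
   they still determine the law. The grid is there because U is only known to be measurable at each
   fixed time: on a grid cell the time is frozen. The paths converge off a null set, whence the
   completeness of P. The exponent -H of the moment comes from V(y) >= e^(-2) y^(2H) for y <= theta:
   there e^(-s-u) is at least e^(-2), and the bare kernel gives y^(2H), the variance of fractional
   Brownian motion. Time 0, where V vanishes, has probability 0 because E(t) has a density. *)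
From HB Require Import structures.
Require Import Defs.
From mathcomp Require Import measurable_realfun zify ring lra.
Import Order.TTheory GRing.Theory Num.Theory.
Import numFieldNormedType.Exports.
Set Implicit Arguments.
Unset Strict Implicit.
Unset Printing Implicit Defensive.
Local Open Scope classical_set_scope.
Local Open Scope ring_scope.

(** * Fundamental theorem of calculus with singular points *)

Section FTC_singular.
Context {R : realType}.
Implicit Types f F : R -> R.
Notation mu := lebesgue_measure.

(** The margin is at most a third of the length, so that even the first interval is nondegenerate,
    as the fundamental theorem on a closed interval requires. *)
Lemma itvoo_bigcup_shrink (a b : R) : a < b ->
  `]a, b[%classic =
  \bigcup_n `[a + (b - a) / n.+3%:R, b - (b - a) / n.+3%:R]%classic.
Proof.
move=> ab; have ba : 0 < b - a by rewrite subr_gt0.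
apply/seteqP; split => [x /=|x [n _] /=]; rewrite !in_itv/= => /andP[ax xb].
  have [m [m1 m2]] : exists m, (b - a) / m.+1%:R <= x - a /\ (b - a) / m.+1%:R <= b - x.
    have : \forall m \near \oo, (b - a) / (Num.min (x - a) (b - x)) <= m%:R by exact: nbhs_infty_ger.
    case=> N _ /(_ N.+1 (leqnSn _)) /=.
    have m0 : 0 < Num.min (x - a) (b - x) by rewrite lt_min !subr_gt0 ax.
    rewrite ler_pdivrMr// mulrC -ler_pdivrMr ?ltr0n// le_min => /andP[h1 h2].
    by exists N.
  exists m => //=; rewrite in_itv/=.
  have h : (b - a) / m.+3%:R <= (b - a) / m.+1%:R.
    by rewrite ler_pM2l// lef_pV2 ?posrE ?ltr0n// ler_nat; lia.
  move: ((b - a) / m.+1%:R) ((b - a) / m.+3%:R) m1 m2 h => u v *.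
  by apply/andP; split; lra.
have : 0 < (b - a) / n.+3%:R by rewrite divr_gt0// ltr0n.
move: ((b - a) / n.+3%:R) ax xb => u *.
by apply/andP; split; lra.
Qed.

(** The integrand may blow up at both ends. On the shrunken closed intervals the usual theorem
    applies; the integrals converge by monotone convergence because f >= 0, the boundary values
    because F is continuous on the whole line. *)
Lemma ge0_FTC2_oo f F (a b : R) : a < b -> measurable_fun setT f ->
  (forall x, a < x < b -> 0 <= f x) ->
  (forall x, a < x < b -> {for x, continuous f}) ->
  continuous F ->
  (forall x, a < x < b -> is_derive x 1 F (f x)) ->
  (\int[mu]_(x in `[a, b]) (f x)%:E = (F b - F a)%:E)%E.
Proof.
move=> ab mf f0 cf cF dF.
have ba : 0 < b - a by rewrite subr_gt0.
rewrite integral_itv_bndoo; last by apply/measurable_EFinP; exact: measurable_funTS.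
rewrite (itvoo_bigcup_shrink ab).
set I := fun n : nat => `[a + (b - a) / n.+3%:R, b - (b - a) / n.+3%:R]%classic.
have step n : 0 < (b - a) / n.+3%:R by rewrite divr_gt0// ltr0n.
have step3 n : (b - a) / n.+3%:R <= (b - a) / 3.
  by rewrite ler_pM2l// lef_pV2 ?posrE ?ltr0n// ler_nat; lia.
have Isub n x : I n x -> a < x < b.
  rewrite /I /= in_itv/= => /andP[h1 h2]; have := step n.
  by move: ((b - a) / n.+3%:R) h1 h2 => u *; apply/andP; split; lra.
have cvg1 : (\int[mu]_(x in I n) (f x)%:E)%E @[n --> \oo] -->
    (\int[mu]_(x in \bigcup_n I n) (f x)%:E)%E.
  apply: ge0_nondecreasing_set_cvg_integral.
  - apply/nondecreasing_seqP => n; rewrite subsetEset => x.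
    rewrite /I/= !in_itv/= => /andP[h1 h2].
    have : (b - a) / n.+4%:R <= (b - a) / n.+3%:R.
      by rewrite ler_pM2l// lef_pV2 ?posrE ?ltr0n// ler_nat; lia.
    move: ((b - a) / n.+4%:R) ((b - a) / n.+3%:R) h1 h2 => u v *.
    by apply/andP; split; lra.
  - by move=> n; exact: measurable_itv.
  - by move=> n; apply/measurable_EFinP; exact: measurable_funTS.
  - by move=> n x Inx; rewrite lee_fin f0// (Isub n).
have cvgs : (b - a) / n.+3%:R @[n --> \oo] --> (0 : R).
  rewrite -(mulr0 (b - a)); apply: cvgM; first exact: cvg_cst.
  have := @cvg_harmonic R; rewrite -(cvg_shiftn 2) => h.
  by apply: cvg_trans h; apply: near_eq_cvg; near=> n; rewrite /= addn2.
have cvg2 : (\int[mu]_(x in I n) (f x)%:E)%E @[n --> \oo] --> (F b - F a)%:E.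
  have -> : (fun n => \int[mu]_(x in I n) (f x)%:E)%E =
      EFin \o (fun n => F (b - (b - a) / n.+3%:R) - F (a + (b - a) / n.+3%:R)).
    apply/funext => n /=.
    have s := step n; have s3 := step3 n.
    rewrite /I (@continuous_FTC2 _ f F)// ?EFinB//.
    - by move: ((b - a) / n.+3%:R) s s3 => u *; lra.
    - apply: continuous_in_subspaceT => x; rewrite inE => Ix.
      by apply: cf; exact: (Isub n).
    - split => [x xI||]; last 2 first.
      + by apply: cvg_at_right_filter; exact: cF.
      + by apply: cvg_at_left_filter; exact: cF.
      have /dF[] // : a < x < b.
      by apply: (Isub n); move: xI; rewrite /I/= !in_itv/= => /andP[/ltW -> /ltW ->].
    - move=> x xI; have /dF h : a < x < b.
        by apply: (Isub n); move: xI; rewrite /I/= !in_itv/= => /andP[/ltW -> /ltW ->].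
      by rewrite derive1E; exact: derive_val.
  apply: cvg_EFin; first exact: nearW.
  apply: cvgB.
    apply: continuous_cvg; first exact: cF.
    by rewrite -[X in _ --> X]subr0; apply: cvgB => //; exact: cvg_cst.
  apply: continuous_cvg; first exact: cF.
  by rewrite -[X in _ --> X]addr0; apply: cvgD => //; exact: cvg_cst.
exact: (cvg_unique _ cvg1 cvg2).
Unshelve. all: by end_near. Qed.

(** Cutting at c leaves two intervals on which only endpoints are singular; the point c is a null
    set and the two values [F c] cancel. For c outside []a, b[] nothing is cut. *)
Lemma ge0_FTC2_singular f F (a b c : R) : a <= b -> measurable_fun setT f ->
  (forall x, a < x < b -> x != c -> 0 <= f x) ->
  (forall x, a < x < b -> x != c -> {for x, continuous f}) ->
  continuous F ->
  (forall x, a < x < b -> x != c -> is_derive x 1 F (f x)) ->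
  (\int[mu]_(x in `[a, b]) (f x)%:E = (F b - F a)%:E)%E.
Proof.
rewrite le_eqVlt => /predU1P[<- *|ab mf f0 cf cF dF].
  by rewrite set_itv1 integral_set1 subrr.
have [/andP[ac cb]|cab] := boolP (a < c < b); last first.
  have H x : a < x < b -> x != c.
    by move=> xab; apply: contraNneq cab => <-.
  by apply: ge0_FTC2_oo => // x xab; [apply: f0|apply: cf|apply: dF] => //; exact: H.
have mfE D : measurable_fun D (EFin \o f).
  by apply/measurable_EFinP; exact: measurable_funTS.
have half (l r : R) : l < r -> a <= l -> r <= b -> (forall x, l < x < r -> x != c) ->
    (\int[mu]_(x in `[l, r]) (f x)%:E = (F r - F l)%:E)%E.
  move=> lr al rb H; apply: ge0_FTC2_oo => // x xlr;
    [apply: f0|apply: cf|apply: dF]; rewrite ?H//;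
    by move: xlr => /andP[h1 h2]; rewrite (le_lt_trans al h1) (lt_le_trans h2 rb).
rewrite integral_itv_bndoo//.
have -> : `]a, b[%classic = `]a, c[%classic `|` (`]c, b[%classic `|` [set c]).
  apply/seteqP; split => x /=; rewrite !in_itv/=.
    by move=> /andP[-> ->]; case: (ltgtP x c) => h /=; auto.
  case=> [/andP[-> h]|[/andP[h ->]|->]]; rewrite ?ac ?cb//; first by rewrite (lt_trans h cb).
  by rewrite (lt_trans ac h).
have oo (l r : R) : (\int[mu]_(x in `]l, r[) (f x)%:E =
    \int[mu]_(x in `[l, r]) (f x)%:E)%E by rewrite [RHS]integral_itv_bndoo.
have f0' x : a < x < b -> x != c -> (0 <= (EFin \o f) x)%E by move=> *; rewrite lee_fin f0.
rewrite (_ : `]a, c[ `|` (`]c, b[ `|` [set c]) = (`]a, c[ `|` `]c, b[) `|` [set c]); last first.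
  by rewrite setUA.
rewrite (_ : _ `|` [set c] = [set x | a < x < b])%classic; last first.
  apply/seteqP; split => x /=; rewrite !in_itv/=.
    case=> [[/andP[-> h]|/andP[h ->]]|->]; rewrite ?ac ?cb//; first by rewrite (lt_trans h cb).
    by rewrite (lt_trans ac h).
  by move=> /andP[-> ->]; case: (ltgtP x c) => h /=; auto.
rewrite -(@integral_setD1 _ (EFin \o f) c [set x | a < x < b]); last 2 first.
- by apply: measurableD => //; rewrite -set_itvoo.
- exact: mfE.
rewrite (_ : _ `\ c = `]a, c[ `|` `]c, b[)%classic; last first.
  apply/seteqP; split => x /=; rewrite !in_itv/=.
    by move=> [/andP[-> ->] /eqP]; case: (ltgtP x c) => h /=; auto.
  case=> /andP[h1 h2]; split.
  - by rewrite h1 (lt_trans h2 cb).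
  - by apply/eqP; rewrite lt_eqF.
  - by rewrite h2 (lt_trans ac h1).
  - by apply/eqP; rewrite gt_eqF.
rewrite ge0_integral_setU//; last 3 first.
- exact: mfE.
- move=> x /=; rewrite !in_itv/= => -[/andP[h1 h2]|/andP[h1 h2]]; apply: f0' => //.
  + by rewrite h1 (lt_trans h2 cb).
  + by rewrite lt_eqF.
  + by rewrite h2 (lt_trans ac h1).
  + by rewrite gt_eqF.
- rewrite disj_set2E; apply/eqP; rewrite -subset0 => x /=; rewrite !in_itv/=.
  by move=> [/andP[_ h1] /andP[h2 _]]; have := lt_trans h1 h2; rewrite ltxx.
rewrite /= !oo (half a c) ?(half c b) ?(ltW ac) ?(ltW cb)//.
- by rewrite -EFinD; congr EFin; ring.
- by move=> x /andP[h _]; rewrite gt_eqF.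
- by move=> x /andP[_ h]; rewrite lt_eqF.
Qed.

End FTC_singular.

(** * Powers of the absolute value, plain and signed *)

Section abs_powers.
Context {R : realType}.
Implicit Types (a x : R).

Lemma is_derive_norm_powR a x : x != 0 ->
  is_derive x 1 (fun y : R => `|y| `^ a) (Num.sg x * (a * `|x| `^ (a - 1))).
Proof.
case: (ltgtP x 0) => [x0 _|x0 _|//].
  rewrite ltr0_sg// (ltr0_norm x0).
  apply: (near_eq_is_derive (f := fun y => (- y) `^ a)).
    by near do rewrite ltr0_norm//; exact: lt_nbhsl.
  have : is_derive x 1 ((@powR R ^~ a) \o -%R) (a * (- x) `^ (a - 1) * -1).
    have nx : 0 < - x by rewrite oppr_gt0.
    exact: (is_derive1_comp (is_derive1_powR a nx) (is_deriveNid x 1)).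
  by rewrite mulrC.
rewrite gtr0_sg// (gtr0_norm x0) mul1r.
apply: (near_eq_is_derive (f := fun y => y `^ a)).
  by near do rewrite gtr0_norm//; exact: lt_nbhsr.
exact: is_derive1_powR.
Unshelve. all: by end_near. Qed.

Lemma is_derive_sg_norm_powR a x : x != 0 ->
  is_derive x 1 (fun y : R => Num.sg y * `|y| `^ a) (a * `|x| `^ (a - 1)).
Proof.
move=> x0.
apply: (near_eq_is_derive (f := fun y => Num.sg x *: `|y| `^ a)).
  case: (ltgtP x 0) x0 => [x0 _|x0 _|//].
    by near=> y; rewrite [in RHS]ltr0_sg ?(ltr0_sg x0)//; near: y; exact: lt_nbhsl.
  by near=> y; rewrite [in RHS]gtr0_sg ?(gtr0_sg x0)//; near: y; exact: lt_nbhsr.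
have := @is_deriveZ _ _ _ _ (Num.sg x) x 1 _ (is_derive_norm_powR a x0).
suff -> : Num.sg x *: (Num.sg x * (a * `|x| `^ (a - 1))) = a * `|x| `^ (a - 1) by [].
by rewrite /GRing.scale/= mulrA -expr2 sqr_sg x0 mul1r.
Unshelve. all: by end_near. Qed.

Lemma is_derive1_continuous (f : R -> R) (x df : R) :
  is_derive x 1 f df -> {for x, continuous f}.
Proof. by case=> h _; apply/differentiable_continuous/derivable1_diffP. Qed.

Lemma norm_powR_cvg0 a : 0 < a -> `|x| `^ a @[x --> (0 : R)] --> (0 : R).
Proof.
move=> a0; apply/cvgrPdist_lt => e e0.
have := powR_cvg0 a0 => /cvgrPdist_lt /(_ e e0) [d /= d0 h].
exists d => //= y /=; rewrite !sub0r !normrN => yd.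
have [->|y0] := eqVneq y 0; first by rewrite normr0 powR0 ?gt_eqF// normr0.
have := h `|y|; rewrite /= !sub0r !normrN normr_id; apply => //.
by rewrite normr_gt0.
Qed.

Lemma continuous_norm_powR a : 0 < a -> continuous (fun x : R => `|x| `^ a).
Proof.
move=> a0 x; have [->|x0] := eqVneq x 0.
  by rewrite /continuous_at normr0 powR0 ?gt_eqF//; exact: norm_powR_cvg0.
exact: (is_derive1_continuous (is_derive_norm_powR a x0)).
Qed.

Lemma continuous_sg_norm_powR a : 0 < a -> continuous (fun x : R => Num.sg x * `|x| `^ a).
Proof.
move=> a0 x; have [->|x0] := eqVneq x 0.
  rewrite /continuous_at sgr0 mul0r.
  apply/cvgrPdist_lt => e e0.
  have /cvgrPdist_lt /(_ e e0) := norm_powR_cvg0 a0; apply: filterS => y.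
  rewrite !sub0r !normrN normrM normr_sg; case: (y == 0) => /=; rewrite ?mul1r// mul0r.
  by move=> *.
exact: (is_derive1_continuous (is_derive_sg_norm_powR a x0)).
Qed.

Lemma continuous_norm_powR_neq0 a x : x != 0 -> {for x, continuous (fun x : R => `|x| `^ a)}.
Proof. by move=> x0; exact: (is_derive1_continuous (is_derive_norm_powR a x0)). Qed.

Lemma is_derive_reflect (f : R -> R) (u x df : R) :
  is_derive (u - x) 1 f df -> is_derive x 1 (fun v => f (u - v)) (- df).
Proof.
move=> h; have : is_derive x 1 (f \o (cst u - id)) (df * (0 - 1)).
  exact: is_derive1_comp.
by rewrite sub0r mulrN1.
Qed.

Lemma is_derive_translate (f : R -> R) (u x df : R) :
  is_derive (x - u) 1 f df -> is_derive x 1 (fun v => f (v - u)) df.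
Proof.
move=> h; have : is_derive x 1 (f \o (id - cst u)) (df * (1 - 0)).
  exact: is_derive1_comp.
by rewrite subr0 mulr1.
Qed.

(** Serves to see that the closed form of the inner kernel integral is nonnegative, as the
    fundamental theorem above demands of its integrand. *)
Lemma nondecreasing_sg_norm_powR a : 0 < a ->
  {homo (fun x : R => Num.sg x * `|x| `^ a) : x y / x <= y}.
Proof.
move=> a0 x y xy /=; have [x0|x0] := leP 0 x.
  have y0 := le_trans x0 xy.
  rewrite !ger0_norm//.
  have [->|xn0] := eqVneq x 0; first by rewrite sgr0 mul0r mulr_ge0 ?sgr_ge0 ?powR_ge0.
  have x1 : 0 < x by rewrite lt_neqAle eq_sym xn0.
  rewrite !gtr0_sg ?(lt_le_trans x1 xy)// !mul1r ge0_ler_powR ?nnegrE//.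
  exact: ltW.
have [y0|y0] := leP 0 y.
  apply: (@le_trans _ _ 0); first by rewrite mulr_le0_ge0 ?powR_ge0// sgr_le0 ltW.
  by rewrite mulr_ge0 ?sgr_ge0 ?powR_ge0.
rewrite !ltr0_sg// !ltr0_norm// !mulN1r lerN2 ge0_ler_powR ?nnegrE ?lerN2//.
- exact: ltW.
- by rewrite oppr_ge0 ltW.
- by rewrite oppr_ge0 ltW.
Qed.

Lemma measurable_norm_powR a : measurable_fun setT (fun x : R => `|x| `^ a).
Proof.
by apply: (@measurableT_comp _ _ _ _ _ _ (@powR R ^~ a)) => //; exact: measurable_powR.
Qed.

End abs_powers.

(** * Integrals of the kernel of fractional Brownian motion *)

Section kernel_integral.
Context {R : realType}.
Notation mu := (@lebesgue_measure R).

(** In v, the kernel has the antiderivative -sg(u - v) |u - v|^b / b, which crosses the singular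
    point v = u continuously because b > 0. The case of interest is b = 2H - 1, between 0 and 1. *)
Lemma integral_kernel1 (b u l r : R) : 0 < b -> l <= r ->
  (\int[mu]_(v in `[l, r]) (`|u - v| `^ (b - 1))%:E)%E =
  (b^-1 * (Num.sg (u - l) * `|u - l| `^ b) - b^-1 * (Num.sg (u - r) * `|u - r| `^ b))%:E.
Proof.
move=> b0 lr.
pose F v := - (b^-1 * (Num.sg (u - v) * `|u - v| `^ b)).
transitivity (F r - F l)%:E; last by rewrite /F; congr EFin; ring.
apply: (@ge0_FTC2_singular _ (fun v => `|u - v| `^ (b - 1)) F l r u) => //.
- apply: (@measurableT_comp _ _ _ _ _ _ (fun x : R => `|x| `^ (b - 1))).
    exact: measurable_norm_powR.
  exact: measurable_funB.
- move=> x _ xu.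
  apply: (@continuous_comp _ _ _ (fun v => u - v) (fun x : R => `|x| `^ (b - 1))).
    by apply: cvgB; [exact: cvg_cst|exact: cvg_id].
  by apply: continuous_norm_powR_neq0; rewrite subr_eq0 eq_sym.
- move=> x; apply: cvgN; apply: cvgM; first exact: cvg_cst.
  apply: (@continuous_comp _ _ _ (fun v => u - v) (fun x : R => Num.sg x * `|x| `^ b)).
    by apply: cvgB; [exact: cvg_cst|exact: cvg_id].
  exact: continuous_sg_norm_powR.
- move=> x _ xu.
  have ux : u - x != 0 by rewrite subr_eq0 eq_sym.
  have h := is_derive_reflect (is_derive_sg_norm_powR b ux).
  have := @is_deriveZ _ _ _ _ (- b^-1) x 1 _ h.
  rewrite /GRing.scale/= mulrN mulNr opprK mulrA mulVf ?gt_eqF// mul1r.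
  congr (is_derive x 1 _ _).
  by apply/funext => v; rewrite /F -mulNr.
Qed.

(** For b = 2H - 1 and after multiplication by H(2H - 1), this is the covariance of fractional
    Brownian motion, whose mixed second derivative is the kernel. *)
Lemma integral_kernel2 (b s t : R) : 0 < b -> 0 <= s -> 0 <= t ->
  (\int[mu]_(u in `[0%R, t]) \int[mu]_(v in `[0%R, s]) (`|u - v| `^ (b - 1))%:E)%E =
  ((t `^ (b + 1) + s `^ (b + 1) - `|t - s| `^ (b + 1)) / (b * (b + 1)))%:E.
Proof.
move=> b0 s0 t0.
under eq_integral do rewrite integral_kernel1//.
have b1 : 0 < b + 1 by lra.
(* An antiderivative of the closed form [G]; its value at 0 is not 0 and supplies the term
   s^(b+1). *)
pose F u := (b * (b + 1))^-1 * (`|u| `^ (b + 1) - `|u - s| `^ (b + 1)).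
pose G (u : R) := b^-1 * (Num.sg (u - 0) * `|u - 0| `^ b) - b^-1 * (Num.sg (u - s) * `|u - s| `^ b).
have cG : continuous G.
  have c1 (w : R) : continuous (fun v : R => b^-1 * (Num.sg (v - w) * `|v - w| `^ b)).
    move=> x; apply: cvgM; first exact: cvg_cst.
    apply: (@continuous_comp _ _ _ (fun v => v - w) (fun x : R => Num.sg x * `|x| `^ b)).
      by apply: cvgB; [exact: cvg_id|exact: cvg_cst].
    exact: continuous_sg_norm_powR.
  by move=> x; apply: cvgB; exact: c1.
transitivity (F t - F 0)%:E; last first.
  congr EFin; rewrite /F normr0 powR0 ?gt_eqF// !sub0r normrN.
  by rewrite (ger0_norm s0) (ger0_norm t0); field; lra.
(* The point s is exceptional only for the derivative rule of |x|^a, which excludes x = 0; [G]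
   itself is continuous there. *)
apply: (@ge0_FTC2_singular _ _ F 0 t s) => //.
- by apply: continuous_measurable_fun; exact: cG.
- move=> x _ _; rewrite -mulrBr mulr_ge0 ?invr_ge0 ?(ltW b0)// subr_ge0.
  by apply: nondecreasing_sg_norm_powR => //; rewrite lerD2l lerN2.
- by move=> x _ _; exact: cG.
- move=> x; apply: cvgM; first exact: cvg_cst.
  apply: cvgB; first exact: continuous_norm_powR.
  apply: (@continuous_comp _ _ _ (fun v => v - s) (fun x : R => `|x| `^ (b + 1))).
    by apply: cvgB; [exact: cvg_id|exact: cvg_cst].
  exact: continuous_norm_powR.
- move=> x /andP[x0 _] xs.
  have x0' : x != 0 by rewrite gt_eqF.
  have xs' : x - s != 0 by rewrite subr_eq0.
  have h1 := is_derive_norm_powR (b + 1) x0'.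
  have h2 := is_derive_translate (is_derive_norm_powR (b + 1) xs').
  have := @is_deriveZ _ _ _ _ ((b * (b + 1))^-1) x 1 _ (is_deriveB h1 h2).
  move=> hh; apply: (is_derive_eq hh).
  by rewrite /GRing.scale/= !addrK /G subr0; field; lra.
Qed.

End kernel_integral.

(** * Gaussian laws and their limits *)

Section normal_moments.
Context {R : realType}.
Notation mu := (@lebesgue_measure R).
Variables (m s : R).
Hypothesis s0 : s != 0.
Let p := normal_pdf m s.
Let I (n : nat) : set R := `[m - n.+1%:R, m + n.+1%:R]%classic.

Let s2_gt0 : 0 < s ^+ 2. Proof. by rewrite exprn_even_gt0. Qed.

Let is_derive_xm (x : R) : is_derive x 1 (fun x => x - m) 1.
Proof.
have := is_deriveB (is_derive_id x 1) (is_derive_cst m x 1).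
by rewrite subr0.
Qed.

Let is_derive_p (x : R) : is_derive x 1 p (- (x - m) / s ^+ 2 * p x).
Proof.
rewrite /p normal_pdfE//.
have h : is_derive x 1 (fun x => - (x - m) ^+ 2 / (s ^+ 2 *+ 2)) (- (x - m) / s ^+ 2).
  have h2 := @is_deriveZ _ _ _ _ (- (s ^+ 2 *+ 2)^-1) x 1 _ (is_deriveX 2 (is_derive_xm x)).
  apply: (@near_eq_is_derive _ _ _ _ _ _ _ _ _ (is_derive_eq h2 _)).
    by near=> y; rewrite /= /GRing.scale/= mulNr mulNr mulrC.
  rewrite /GRing.scale/= ; field.
  by rewrite s0.
have h3 := is_derive1_comp (is_derive_expR _) h.
have := @is_deriveZ _ _ _ _ (normal_peak s) x 1 _ h3.
move=> hh; apply: (is_derive_eq hh); rewrite /GRing.scale/= /normal_fun; ring.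
Unshelve. all: by end_near. Qed.

Let cp : continuous p.
Proof. exact: continuous_normal_pdf. Qed.

Let IS n : I n `<=` I n.+1.
Proof.
move=> x; rewrite /I/= !in_itv/= => /andP[h1 h2].
have : n.+1%:R <= n.+2%:R :> R by rewrite ler_nat.
by move: (n.+1%:R) (n.+2%:R) h1 h2 => u v *; apply/andP; split; lra.
Qed.

Let I_bigcup : \bigcup_n I n = setT.
Proof.
apply/seteqP; split => // x _.
have : \forall k \near \oo, `|x - m| <= k%:R by exact: nbhs_infty_ger.
case=> N _ /(_ N.+1 (leqnSn _)) /= h.
exists N => //; rewrite /I/= in_itv/=; move: h; rewrite ler_norml.
by move: (N.+1%:R) => u /andP[*]; apply/andP; split; lra.
Qed.

(** With y = k^2 / (2 s^2), the inequality e^y >= 1 + y >= y bounds the Gaussian factor by 2 s^2 /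
    k^2, so that the boundary term k p(m + k) is O(1/k). *)
Let p_edge (n : nat) : 0 <= n.+1%:R * p (m + n.+1%:R) <= 2 * s ^+ 2 * normal_peak s * n.+1%:R^-1.
Proof.
rewrite mulr_ge0 ?normal_pdf_ge0//=.
rewrite /p normal_pdfE// /normal_fun (_ : m + n.+1%:R - m = n.+1%:R); last by ring.
set k := n.+1%:R; have k0 : 0 < k :> R by rewrite ltr0n.
set y := k ^+ 2 / (s ^+ 2 *+ 2).
have y0 : 0 < y by rewrite divr_gt0 ?exprn_gt0// pmulrn_lgt0.
rewrite mulNr -/y expRN.
have : (expR y)^-1 <= y^-1.
  rewrite lef_pV2 ?posrE ?expR_gt0//; apply: le_trans (expR_ge1Dx y); lra.
move=> h; apply: (@le_trans _ _ (k * (normal_peak s * y^-1))).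
  by rewrite ler_pM2l// ler_wpM2l// normal_peak_ge0.
rewrite le_eqVlt; apply/orP; left; apply/eqP; rewrite /y; field.
by rewrite s0 gt_eqF.
Qed.

Let p_edge_cvg0 : n.+1%:R * p (m + n.+1%:R) @[n --> \oo] --> (0 : R).
Proof.
apply: (@squeeze_cvgr _ _ _ _ (cst 0) (fun n => 2 * s ^+ 2 * normal_peak s * n.+1%:R^-1)).
- by near=> n; exact: p_edge.
- exact: cvg_cst.
- rewrite -(mulr0 (2 * s ^+ 2 * normal_peak s)); apply: cvgM; first exact: cvg_cst.
  exact: cvg_harmonic.
Unshelve. all: by end_near. Qed.

Let p_sym x : p (m - x) = p (m + x).
Proof. by rewrite /p normal_pdfE// /normal_fun; congr (_ * expR _); ring. Qed.

Let integral_I (f F : R -> R) (n : nat) : continuous f ->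
  (forall x : R, is_derive x 1 F (f x)) ->
  (\int[mu]_(x in I n) (f x)%:E = (F (m + n.+1%:R) - F (m - n.+1%:R))%:E)%E.
Proof.
move=> cf dF; rewrite /I (@continuous_FTC2 _ f F) ?EFinB//.
- have : 0 < n.+1%:R :> R by rewrite ltr0n.
  by move: (n.+1%:R) => u *; lra.
- exact: continuous_subspaceT.
- have cF x : {for x, continuous F}.
    have [h _] := dF x.
    by apply/differentiable_continuous/derivable1_diffP.
  split => [x _||]; first by have [] := dF x.
  + by apply: cvg_at_right_filter; exact: cF.
  + by apply: cvg_at_left_filter; exact: cF.
- by move=> x _; rewrite derive1E; exact: derive_val.
Qed.

Let cxm : continuous (fun x : R => x - m).
Proof. by move=> x; apply: cvgB; [exact: cvg_id|exact: cvg_cst]. Qed.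

Let mI n : measurable (I n). Proof. exact: measurable_itv. Qed.

Lemma normal_second_moment :
  (\int[mu]_x ((x - m) ^+ 2 * normal_pdf m s x)%:E = (s ^+ 2)%:E)%E.
Proof.
have c2 : continuous (fun x : R => (x - m) ^+ 2 * p x).
  move=> x; apply: cvgM; last exact: cp.
  by apply: (@continuous_comp _ _ _ (fun x => x - m) (fun y => y ^+ 2)); [exact: cxm|exact: exprn_continuous].
have m2 : measurable_fun setT (fun x : R => (x - m) ^+ 2 * p x) by exact: continuous_measurable_fun.
have h1 : (\int[mu]_(x in I n) ((x - m) ^+ 2 * p x)%:E)%E @[n --> \oo] -->
    (\int[mu]_x ((x - m) ^+ 2 * p x)%:E)%E.
  rewrite -I_bigcup; apply: ge0_nondecreasing_set_cvg_integral => //.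
  - by apply/nondecreasing_seqP => n; rewrite subsetEset.
  - by move=> n; apply/measurable_EFinP; exact: measurable_funTS.
  - by move=> n x _; rewrite lee_fin mulr_ge0 ?sqr_ge0// normal_pdf_ge0.
have h2 : (\int[mu]_(x in I n) (p x)%:E)%E @[n --> \oo] --> (1 : \bar R)%E.
  rewrite -(integral_normal_pdf m s) -I_bigcup.
  apply: ge0_nondecreasing_set_cvg_integral => //.
  - by apply/nondecreasing_seqP => n; rewrite subsetEset.
  - by move=> n; apply/measurable_EFinP; apply: measurable_funTS; exact: continuous_measurable_fun.
  - by move=> n x _; rewrite lee_fin normal_pdf_ge0.
(* ((x - m)^2 - s^2) p is the derivative of - s^2 (x - m) p, which vanishes at
   infinity. *)
have h3 n : (\int[mu]_(x in I n) ((x - m) ^+ 2 * p x)%:E =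
   (s ^+ 2)%:E * \int[mu]_(x in I n) (p x)%:E +
   (- (2 * s ^+ 2) * (n.+1%:R * p (m + n.+1%:R)))%:E)%E.
  have ip : mu.-integrable (I n) (EFin \o p).
    by apply: (integrableS _ _ _ (integrable_normal_pdf m s)) => //; exact: mI.
  have i2 : mu.-integrable (I n) (EFin \o (fun x : R => (x - m) ^+ 2 * p x)).
    apply: continuous_compact_integrable; first exact: segment_compact.
    exact: continuous_subspaceT.
  have h := @integral_I (fun x : R => (x - m) ^+ 2 * p x - s ^+ 2 * p x)
    (fun x : R => - s ^+ 2 * ((x - m) * p x)) n.
  have e : (\int[mu]_(x in I n) ((x - m) ^+ 2 * p x - s ^+ 2 * p x)%:E =
      \int[mu]_(x in I n) ((x - m) ^+ 2 * p x)%:E - (s ^+ 2)%:E * \int[mu]_(x in I n) (p x)%:E)%E.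
    under eq_integral do rewrite EFinB (EFinM (s ^+ 2)).
    rewrite integralB; [congr (_ - _)%E; apply: integralZl; [exact: mI|exact: ip]|exact: mI|exact: i2|].
    by apply: integrableZl; [exact: mI|exact: ip].
  rewrite e in h.
  have {}h : (\int[mu]_(x in I n) ((x - m) ^+ 2 * p x)%:E - (s ^+ 2)%:E * \int[mu]_(x in I n) (p x)%:E
     = (- (2 * s ^+ 2) * (n.+1%:R * p (m + n.+1%:R)))%:E)%E.
    apply: etrans; first apply: h.
    - move=> x; apply: cvgB; first exact: c2.
      by apply: cvgM; [exact: cvg_cst|exact: cp].
    - move=> x.
      have hh := @is_deriveZ _ _ _ _ (- s ^+ 2) x 1 _ (is_deriveM (is_derive_xm x) (is_derive_p x)).
      by apply: (is_derive_eq hh); rewrite /GRing.scale/=; field.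
    - by congr EFin; rewrite p_sym; ring.
  rewrite -h [RHS]addeC subeK//.
  by rewrite fin_numM//; apply: integrable_fin_num; [exact: mI|exact: ip].
have h4 : (\int[mu]_(x in I n) ((x - m) ^+ 2 * p x)%:E)%E @[n --> \oo] --> (s ^+ 2)%:E.
  under eq_fun do rewrite h3.
  rewrite -[nbhs (s ^+ 2)%:E](congr1 nbhs (_ : (s ^+ 2)%:E * 1 + 0 = _)%E); last by rewrite mule1 adde0.
  have k1 := cvgeZl (isT : (s ^+ 2)%:E \is a fin_num) h2.
  apply: (cvgeD _ k1); first by [].
  apply: cvg_EFin; first exact: nearW.
  by rewrite -(mulr0 (- (2 * s ^+ 2))); apply: cvgM; [exact: cvg_cst|exact: p_edge_cvg0].
exact: (cvg_unique _ h1 h4).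
Qed.

Lemma integrable_normal_sqr_center :
  mu.-integrable setT (EFin \o (fun x : R => (x - m) ^+ 2 * normal_pdf m s x)).
Proof.
have m2 : measurable_fun setT (fun x : R => (x - m) ^+ 2 * p x).
  apply: measurable_funM; last exact: continuous_measurable_fun.
  by apply: measurable_funX; exact: continuous_measurable_fun.
apply/integrableP; split; first exact/measurable_EFinP.
rewrite (_ : (\int[mu]_x _)%E = (s ^+ 2)%:E) ?ltry// -normal_second_moment.
apply: eq_integral => x _ /=; rewrite ger0_norm//.
by apply: mulr_ge0; [exact: sqr_ge0|exact: normal_pdf_ge0].
Qed.

Lemma integrable_normal_center :
  mu.-integrable setT (EFin \o (fun x : R => (x - m) * normal_pdf m s x)).
Proof.
have m1 : measurable_fun setT (fun x : R => (x - m) * p x).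
  by apply: measurable_funM; exact: continuous_measurable_fun.
pose q (x : R) := (x - m) ^+ 2 * p x.
apply: (@le_integrable _ _ _ mu _ measurableT _ ((EFin \o q) \+ (EFin \o p))%E).
- exact/measurable_EFinP.
- move=> x _ /=; rewrite lee_fin.
  have p0 : 0 <= p x by exact: normal_pdf_ge0.
  rewrite normrM (ger0_norm p0) (ger0_norm (x := q x + p x)); last first.
    by apply: addr_ge0 => //; apply: mulr_ge0 => //; exact: sqr_ge0.
  rewrite /q -[X in _ <= _ + X]mul1r -mulrDl ler_wpM2r//.
  rewrite -(ger0_norm (sqr_ge0 (x - m))) normrX.
  by move: `|x - m| (normr_ge0 (x - m)) => u u0; nra.
- apply: integrableD => //; first exact: integrable_normal_sqr_center.
  exact: integrable_normal_pdf.
Qed.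

(** (x - m) p is the derivative of -s^2 p, which takes equal values at points symmetric about m: the
    integral over each [I n] is 0. As the sign changes, dominated rather than monotone convergence
    passes to the whole line. *)
Lemma normal_centered_moment :
  (\int[mu]_x ((x - m) * normal_pdf m s x)%:E = 0)%E.
Proof.
have c1 : continuous (fun x : R => (x - m) * p x).
  by move=> x; apply: cvgM; [exact: cxm|exact: cp].
have h1 n : (\int[mu]_(x in I n) ((x - m) * p x)%:E = 0)%E.
  apply: etrans; first apply: (@integral_I _ (fun x : R => - s ^+ 2 * p x) n c1); last by rewrite /= p_sym subrr.
  move=> x; have hh := @is_deriveZ _ _ _ _ (- s ^+ 2) x 1 _ (is_derive_p x).
  by apply: (is_derive_eq hh); rewrite /GRing.scale/=; field.
have := @dominated_convergence _ _ R mu setT measurableT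
  (fun n => EFin \o ((fun x : R => (x - m) * p x) \_ (I n)))
  (EFin \o (fun x : R => (x - m) * p x)) (fun x : R => `|(x - m) * p x|%:E).
case.
- move=> n; apply/measurable_EFinP; apply/(measurable_restrictT _ (mI n)).
  by apply: measurable_funTS; exact: continuous_measurable_fun.
- by apply/measurable_EFinP; exact: continuous_measurable_fun.
- apply: aeW => x _ /=; apply: cvg_EFin; first exact: nearW.
  apply: cvg_near_cst.
  have : [set: R] x by []. rewrite -I_bigcup => -[N _ INx].
  exists N => // n /= Nn; rewrite patchE mem_set//.
  move: INx; elim: n Nn => [|n ih]; first by rewrite leqn0 => /eqP ->.
  by rewrite leq_eqVlt => /predU1P[->//|/ih h /h]; exact: IS.
- exact: integrable_norm integrable_normal_center.
- apply: aeW => n x _ /=; rewrite lee_fin patchE; case: ifP => // _.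
  by rewrite normr0.
move=> _ _ h2.
have h3 : (\int[mu]_x (EFin \o ((fun x : R => ((x - m) * p x)%R) \_ (I n))) x)%E @[n --> \oo] --> 0%E.
  have e n : (\int[mu]_x (EFin \o ((fun x : R => ((x - m) * p x)%R) \_ (I n))) x = 0)%E.
    rewrite -(h1 n) [RHS]integral_mkcond; apply: eq_integral => x _.
    by rewrite restrict_EFin.
  by under eq_fun do rewrite e; exact: cvg_cst.
exact: (cvg_unique _ h2 h3).
Qed.

End normal_moments.

(* [pushforward] is a measure only in the presence of a proof of measurability,
   which canonical structure inference cannot supply. *)
Definition image_measure d d' (T : measurableType d) (T' : measurableType d')
  (R : realType) (m : {measure set T -> \bar R}) (f : T -> T')
  (mf : measurable_fun setT f) : {measure set T' -> \bar R}.
Proof.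
by unshelve refine (pushforward m f : {measure set T' -> \bar R}); exact: mf.
Defined.

(** * Change of measure and laws with a density *)

Section integral_density.
Context d (T : measurableType d) (R : realType).
Variables (mu nu : {measure set T -> \bar R}) (f : T -> R).
Hypotheses (mf : measurable_fun setT f) (f0 : forall x, 0 <= f x)
  (nuE : forall A, measurable A -> nu A = (\int[mu]_(x in A) (f x)%:E)%E).

Import HBNNSimple.

(** Both sides agree on indicators by [nuE], hence on nonnegative simple functions, and monotone
    convergence does the rest. It is applied to laws of random variables and to P restricted to an
    event, with the indicator of the event as f. *)
Lemma ge0_integral_density (h : T -> \bar R) : measurable_fun setT h ->
  (forall x, 0 <= h x)%E ->
  (\int[nu]_x h x = \int[mu]_x (h x * (f x)%:E))%E.
Proof.
move=> mh h0; pose h_ := nnsfun_approx measurableT mh.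
have mEf : measurable_fun setT (EFin \o f) by exact/measurable_EFinP.
have hf_cvg x : (fun n => ((h_ n x)%:E * (f x)%:E)%E) @ \oo --> (h x * (f x)%:E)%E.
  by apply: cvgeZr => //; exact: cvg_nnsfun_approx.
transitivity (limn (fun n => \int[nu]_x (h_ n x)%:E))%E.
  rewrite -monotone_convergence//.
  - by apply: eq_integral => x _; apply/esym/cvg_lim => //; exact: cvg_nnsfun_approx.
  - by move=> n; exact/measurable_EFinP.
  - by move=> *; rewrite lee_fin.
  - by move=> x _ m n mn; rewrite lee_fin; exact/lefP/nd_nnsfun_approx.
transitivity (limn (fun n => \int[mu]_x ((h_ n x)%:E * (f x)%:E)))%E; last first.
  rewrite -monotone_convergence//.
  - by apply: eq_integral => x _; apply/cvg_lim => //; exact: hf_cvg.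
  - by move=> n; apply: emeasurable_funM => //; exact/measurable_EFinP.
  - by move=> n x _; rewrite mule_ge0// lee_fin.
  - move=> x _ m n mn; rewrite lee_wpmul2r ?lee_fin//.
    exact/lefP/nd_nnsfun_approx.
congr (limn _); apply/funext => n.
under eq_integral do rewrite fimfunE -fsumEFin//.
rewrite ge0_integral_fsum//; last 2 first.
- by move=> r; exact/measurable_EFinP/measurableT_comp.
- by move=> r x _; rewrite nnfun_muleindic_ge0.
under eq_fsbigr do rewrite integralZl_indic_nnsfun//.
under [RHS]eq_integral => x _.
  rewrite fimfunE -fsumEFin// ge0_mule_fsuml; last by move=> r; rewrite nnfun_muleindic_ge0.
  over.
rewrite ge0_integral_fsum//; last 2 first.
- move=> r; apply: emeasurable_funM => //.
  by exact/measurable_EFinP/measurableT_comp.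
- by move=> r x _; rewrite mule_ge0 ?nnfun_muleindic_ge0// lee_fin.
apply: eq_fsbigr => r _.
pose A : set T := h_ n @^-1` [set r].
have mA : measurable A by exact: measurable_sfunP.
transitivity (r%:E * \int[nu]_x (\1_A x)%:E)%E; first by [].
transitivity (\int[mu]_x ((r * \1_A x)%:E * (f x)%:E))%E; last by [].
have [r0|r0] := ltP r 0.
  have -> : A = set0 by apply: preimage_nnfun0.
  rewrite integral_indic// set0I measure0 mule0 integral0_eq// => x _.
  by rewrite indic0 /= mulr0 mul0e.
rewrite integral_indic// setIT nuE//.
transitivity (\int[mu]_x (r%:E * ((\1_A x)%:E * (f x)%:E)))%E; last first.
  by apply: eq_integral => x _; rewrite EFinM muleA.
rewrite ge0_integralZl//; last 2 first.
- apply: emeasurable_funM => //; exact/measurable_EFinP.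
- by move=> x _; rewrite mule_ge0// lee_fin.
congr (_ * _)%E; rewrite integral_mkcond; apply: eq_integral => x _.
by rewrite patchE indicE; case: ifPn => _; rewrite ?mul1e ?mul0e.
Qed.

(** Positive and negative parts are transported separately; both integrals are by definition the
    difference of these two parts, so that h may be any measurable function. *)
Lemma integral_density (h : T -> \bar R) : measurable_fun setT h ->
  (\int[nu]_x h x = \int[mu]_x (h x * (f x)%:E))%E.
Proof.
move=> mh; rewrite integralE [RHS]integralE; congr (_ - _)%E.
  rewrite ge0_integral_density//; last exact: measurable_funepos.
  apply: eq_integral => x _; rewrite !funeposE.
  by rewrite maxe_pMl ?lee_fin// mul0e.
rewrite ge0_integral_density//; last exact: measurable_funeneg.
apply: eq_integral => x _; rewrite !funenegE.
by rewrite maxe_pMl ?lee_fin// mul0e mulNe.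
Qed.

End integral_density.

Section density_expectation.
Context d (T : measurableType d) (R : realType) (P : probability T R).
Notation mu := (@lebesgue_measure R).
Variables (X : T -> R) (p : R -> R).
Hypothesis Xp : has_density P X p.

Let mX : measurable_fun setT X. Proof. by case: Xp. Qed.
Let mX' : measurable_fun setT (X : T -> measurableTypeR R). Proof. exact: mX. Qed.
Let law := image_measure P mX'.

Lemma ge0_integral_has_density (h : R -> \bar R) : measurable_fun setT h ->
  (forall x, 0 <= h x)%E ->
  (\int[P]_w h (X w) = \int[mu]_x (h x * (p x)%:E))%E.
Proof.
case: Xp => _ mp p0 XpE mh h0.
rewrite -(@ge0_integral_density _ _ R mu law p)//.
by rewrite ge0_integral_pushforward.
Qed.

Lemma integral_has_density (h : R -> \bar R) : measurable_fun setT h ->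
  (\int[P]_w h (X w) = \int[mu]_x (h x * (p x)%:E))%E.
Proof.
case: Xp => _ mp p0 XpE mh.
transitivity (\int[law]_x h x)%E; last exact: integral_density.
rewrite [LHS]integralE [RHS]integralE.
have mhp := measurable_funepos mh.
have mhn := measurable_funeneg mh.
congr (_ - _)%E.
  rewrite ge0_integral_pushforward// preimage_setT.
  by apply: eq_integral => x _; rewrite /= !funeposE.
rewrite ge0_integral_pushforward// preimage_setT.
by apply: eq_integral => x _; rewrite /= !funenegE.
Qed.

End density_expectation.

(** The parameter is the variance, so that [fOU_pdf H theta t] is by unfolding
    [centered_gauss_pdf (fOU_var H theta t)]. *)
Definition centered_gauss_pdf (R : realType) (v x : R) : R :=
  (Num.sqrt (2 * pi * v))^-1 * expR (- (x ^+ 2 / (2 * v))).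

Lemma normal_pdf_centered (R : realType) (s x : R) : s != 0 ->
  normal_pdf 0 s x = centered_gauss_pdf (s ^+ 2) x.
Proof.
move=> s0; rewrite normal_pdfE// /normal_peak /normal_fun /centered_gauss_pdf.
congr ((Num.sqrt _)^-1 * expR _); first by ring.
by rewrite subr0 mulNr; congr (- (_ / _)); ring.
Qed.

Section gaussian_law.
Context d (T : measurableType d) (R : realType) (P : probability T R).
Notation mu := (@lebesgue_measure R).
Implicit Types (J X : T -> R).

Lemma integrable_of_sqr J (v : R) : measurable_fun setT J ->
  'E_P[fun w => (J w ^+ 2)%R]%E = v%:E -> P.-integrable setT (EFin \o J).
Proof.
move=> mJ J2; have mJ2 : measurable_fun setT (fun w => J w ^+ 2) by exact: measurable_funX.
have iJ2 : P.-integrable setT (EFin \o (fun w => J w ^+ 2)).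
  apply/integrableP; split; first exact/measurable_EFinP.
  rewrite (_ : (\int[P]_x _)%E = v%:E) ?ltry// -J2 unlock.
  by apply: eq_integral => w _ /=; rewrite ger0_norm// sqr_ge0.
have i1 : P.-integrable setT (EFin \o cst 1) by exact: finite_measure_integrable_cst.
apply: (le_integrable measurableT _ _ (integrableD measurableT iJ2 i1)).
  exact/measurable_EFinP.
move=> w _ /=; rewrite lee_fin [leRHS]ger0_norm ?addr_ge0 ?sqr_ge0//.
rewrite -(ger0_norm (sqr_ge0 (J w))) normrX.
by move: `|J w| (normr_ge0 (J w)) => u u0; nra.
Qed.

(** [is_gaussian] only grants some m and s. The first moment of the normal law forces m = 0 and the
    second s^2 = v; the sign of s stays free, which the density does not see. *)
Lemma centered_gauss_density J (v : R) : is_gaussian P J -> 'E_P[J]%E = 0%E ->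
  'E_P[fun w => (J w ^+ 2)%R]%E = v%:E -> 0 < v ->
  has_density P J (centered_gauss_pdf v).
Proof.
move=> [mJ [m [s lawJ]]] EJ EJ2 v0.
have iJ := integrable_of_sqr mJ EJ2.
(* A Dirac law would have E[J^2] = (E[J])^2 = 0. *)
have [s0|s0] := eqVneq s 0.
  have Jm : ae_eq P setT J (cst m).
    exists (J @^-1` (~` [set m])); split.
    - by rewrite -[X in measurable X]setTI; apply: mJ => //; exact: measurableC.
    - apply: etrans; first by apply: lawJ; exact: measurableC.
      by rewrite s0 eqxx diracE memNset//; apply.
    - by move=> w /= h e; apply: h => _.
  have mm : m = 0.
    have : 'E_P[J]%E = m%:E.
      rewrite -(expectation_cst P m) unlock; apply: ae_eq_integral => //.
      - exact/measurable_EFinP.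
      - exact: (measurable_cst m%:E).
      - exact: (ae_eq_comp EFin Jm).
    by rewrite EJ => -[->].
  have : 'E_P[fun w => (J w ^+ 2)%R]%E = (m ^+ 2)%:E.
    rewrite -(expectation_cst P (m ^+ 2)) unlock; apply: ae_eq_integral => //.
    - exact/measurable_EFinP/measurable_funX.
    - exact: (measurable_cst (m ^+ 2)%:E).
    - exact: (ae_eq_comp (fun x => (x ^+ 2)%:E) Jm).
  by rewrite EJ2 mm expr0n/= => -[] v00; move: v0; rewrite v00 ltxx.
have Jd : has_density P J (normal_pdf m s).
  split => //; first exact: measurable_normal_pdf.
    by move=> x; exact: normal_pdf_ge0.
  by move=> A mA; rewrite lawJ// (negbTE s0).
have m0 : m = 0.
  have := integral_has_density Jd (h := fun x => (x - m)%:E).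
  move=> /(_ (measurableT_comp (@EFin_measurable _ _) (measurable_funB (@measurable_id _ _ _) (measurable_cst _)))).
  under [X in _ = X]eq_integral do rewrite -EFinM.
  rewrite normal_centered_moment//.
  under eq_integral do rewrite EFinB.
  rewrite integralB//; last exact: finite_measure_integrable_cst.
  have -> : (\int[P]_(_ in setT) m%:E)%E = m%:E by rewrite -[RHS](expectation_cst P m) unlock.
  move: EJ; rewrite unlock => ->; rewrite sub0e.
  by move=> [] /eqP; rewrite oppr_eq0 => /eqP.
have sv : s ^+ 2 = v.
  have := ge0_integral_has_density Jd (h := fun x => (x ^+ 2)%:E).
  move=> /(_ _ _).
  have -> : (\int[P]_w (J w ^+ 2)%:E)%E = v%:E by rewrite -EJ2 unlock.
  have := normal_second_moment m s0; rewrite m0.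
  under eq_integral do rewrite subr0 EFinM.
  move=> -> h; apply/esym.
  suff : v%:E = (s ^+ 2)%:E by case.
  apply: h; last by move=> x; rewrite lee_fin sqr_ge0.
  exact/measurable_EFinP/measurable_funX.
rewrite -sv; have -> // : centered_gauss_pdf (s ^+ 2) = normal_pdf m s.
by apply/funext => x; rewrite m0 normal_pdf_centered.
Qed.

End gaussian_law.

(** * Limits of centered Gaussian laws *)

Section gaussian_limit.
Context {R : realType}.
Notation mu := (@lebesgue_measure R).
Implicit Types (v x : R) (phi : R -> R).

Lemma centered_gauss_pdf_ge0 v x : 0 <= centered_gauss_pdf v x.
Proof. by rewrite mulr_ge0 ?invr_ge0 ?sqrtr_ge0 ?expR_ge0. Qed.

Lemma centered_gauss_pdfE v : 0 < v -> centered_gauss_pdf v = normal_pdf 0 (Num.sqrt v).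
Proof.
move=> v0; apply/funext => x; rewrite normal_pdf_centered ?sqr_sqrtr ?(ltW v0)//.
by rewrite gt_eqF// sqrtr_gt0.
Qed.

Lemma measurable_centered_gauss_pdf v : measurable_fun setT (@centered_gauss_pdf R v).
Proof.
apply: measurable_funM => //; apply: measurableT_comp => //.
by apply: measurableT_comp => //; apply: measurable_funM.
Qed.

Lemma integrable_centered_gauss_pdf v : 0 < v ->
  mu.-integrable setT (fun x => (centered_gauss_pdf v x)%:E).
Proof. by move=> v0; rewrite centered_gauss_pdfE//; exact: integrable_normal_pdf. Qed.

(** The ratio of the normalizing factors is sqrt(2v / w) <= 2, and the exponential grows with the
    variance. This gives one integrable majorant for all variances near v. *)
Lemma centered_gauss_pdf_le v w x : 0 < v -> v / 2 <= w <= 2 * v ->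
  centered_gauss_pdf w x <= 2 * centered_gauss_pdf (2 * v) x.
Proof.
move=> v0 /andP[w1 w2]; rewrite /centered_gauss_pdf [leRHS]mulrA ler_pM ?invr_ge0 ?sqrtr_ge0 ?expR_ge0//.
  have pi0 := pi_gt0 R.
  have e1 : 0 < Num.sqrt (2 * pi * w) by rewrite sqrtr_gt0; nra.
  have e2 : 0 < Num.sqrt (2 * pi * (2 * v)) by rewrite sqrtr_gt0; nra.
  rewrite -[leLHS]mul1r ler_pdivrMr// [leRHS]mulrAC ler_pdivlMr// mul1r [leRHS]mulrC.
  rewrite (_ : Num.sqrt (2 * pi * w) * 2 = Num.sqrt (2 * pi * (2 * (2 * w)))).
    by rewrite ler_sqrt; nra.
  rewrite (_ : 2 * pi * (2 * (2 * w)) = 2 * pi * w * 2 ^+ 2); last by ring.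
  rewrite (sqrtrM (2 ^+ 2)) ?sqrtr_sqr ?ger0_norm//; nra.
rewrite ler_expR lerN2; apply: ler_wpM2l; first exact: sqr_ge0.
by rewrite lef_pV2 ?posrE; lra.
Qed.

Lemma continuous_centered_gauss_pdf x v : 0 < v ->
  {for v, continuous (fun w => centered_gauss_pdf w x)}.
Proof.
move=> v0; have pi0 := pi_gt0 R.
have c1 : (Num.sqrt (2 * pi * w))^-1 @[w --> v] --> (Num.sqrt (2 * pi * v))^-1.
  apply: cvgV; first by rewrite gt_eqF// sqrtr_gt0; nra.
  apply: continuous_cvg; first exact: sqrt_continuous.
  by apply: cvgM; [exact: cvg_cst|exact: cvg_id].
have c2 : expR (- (x ^+ 2 / (2 * w))) @[w --> v] --> expR (- (x ^+ 2 / (2 * v))).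
  apply: continuous_cvg; first exact: continuous_expR.
  apply: cvgN; apply: cvgM; first exact: cvg_cst.
  apply: cvgV; first by rewrite gt_eqF//; lra.
  by apply: cvgM; [exact: cvg_cst|exact: cvg_id].
exact: cvgM c1 c2.
Qed.

Lemma cvg_centered_gauss_integral (v_ : nat -> R) v phi : 0 < v ->
  v_ @ \oo --> v -> measurable_fun setT phi -> (forall x, 0 <= phi x <= 1) ->
  (\int[mu]_x (phi x * centered_gauss_pdf (v_ n) x)%:E)%E @[n --> \oo] -->
  (\int[mu]_x (phi x * centered_gauss_pdf v x)%:E)%E.
Proof.
move=> v0 vv mphi phi01.
have [N _ HN] : \forall n \near \oo, v / 2 <= v_ n <= 2 * v.
  near=> n; apply/andP; split.
    by near: n; apply: (cvgr_ge v) => //; lra.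
  by near: n; apply: (cvgr_le v) => //; lra.
have m2 w : measurable_fun setT (fun x => phi x * centered_gauss_pdf w x).
  by apply: measurable_funM => //; exact: measurable_centered_gauss_pdf.
(* Dropping the first N terms makes the majorant valid at every index. *)
rewrite -(cvg_shiftn N).
have := @dominated_convergence _ _ R mu setT measurableT
  (fun n x => (phi x * centered_gauss_pdf (v_ (n + N)) x)%:E)
  (fun x => (phi x * centered_gauss_pdf v x)%:E)
  (fun x => (2 * centered_gauss_pdf (2 * v) x)%:E).
case=> //.
- by move=> n; apply/measurable_EFinP; exact: m2.
- by apply/measurable_EFinP; exact: m2.
- apply: aeW => x _ /=; apply: cvg_EFin; first exact: nearW.
  apply: cvgM; first exact: cvg_cst.
  have vN : v_ (n + N)%N @[n --> \oo] --> v by rewrite (cvg_shiftn N).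
  exact: (@cvg_comp _ _ _ _ _ _ _ _ vN (continuous_centered_gauss_pdf v0)).
- have v20 : 0 < 2 * v by lra.
  exact: (integrableZl measurableT 2 (integrable_centered_gauss_pdf v20)).
- apply: aeW => x n _ /=; rewrite lee_fin.
  have /andP[p0 p1] := phi01 x.
  rewrite ger0_norm ?mulr_ge0 ?centered_gauss_pdf_ge0//.
  apply: le_trans (centered_gauss_pdf_le x v0 (HN (n + N)%N _)); last exact: leq_addl.
  by rewrite ler_piMl// centered_gauss_pdf_ge0.
Unshelve. all: by end_near. Qed.

End gaussian_limit.

Section L2_limit.
Context d (T : measurableType d) (R : realType) (P : probability T R).
Notation mu := (@lebesgue_measure R).
Variables (phi : R -> R) (L : R).
Hypotheses (phi01 : forall x, 0 <= phi x <= 1)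
  (phiL : forall x y, `|phi x - phi y| <= L * `|x - y|).

Lemma lipschitz_continuous_fun : continuous phi.
Proof.
have L0 : 0 <= L by have := phiL 1 0; rewrite subr0 normr1 mulr1; apply: le_trans.
move=> x; apply/cvgrPdist_le => e e0.
near=> y; apply: le_trans (phiL _ _) _.
(* [L + 1] is positive even when L = 0, so that it can be divided by. *)
apply: (@le_trans _ _ ((L + 1) * `|x - y|)); first by rewrite ler_wpM2r// lerDl.
rewrite -ler_pdivlMl; last by lra.
near: y; apply: cvgr_dist_le; first exact: cvg_id.
by rewrite mulr_gt0// invr_gt0; lra.
Unshelve. all: by end_near. Qed.

Let mphi : measurable_fun setT phi.
Proof. exact: continuous_measurable_fun lipschitz_continuous_fun. Qed.

Lemma integrable_lipschitz01 (X : T -> R) : measurable_fun setT X ->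
  P.-integrable setT (fun w => (phi (X w))%:E).
Proof.
move=> mX; apply: (@measurable_bounded_integrable _ _ _ P (fun w => phi (X w)) setT) => //.
- by rewrite (le_lt_trans (probability_le1 _ _))// ltry.
- exact: measurableT_comp.
- exists 1; split; rewrite ?num_real// => x x1 w _ /=.
  by have /andP[p0 p1] := phi01 (X w); rewrite ger0_norm// (le_trans p1)// ltW.
Qed.

(** For u = |J n - X|, a bound on L u by an arbitrary e plus a multiple of u^2 trades the first
    moment of u for the second, which tends to 0. *)
Lemma L2_cvg_expectation (J : nat -> T -> R) (X : T -> R) :
  (forall n, measurable_fun setT (J n)) -> measurable_fun setT X ->
  'E_P[fun w => ((J n w - X w) ^+ 2)%R]%E @[n --> \oo] --> 0%E ->
  (\int[P]_w (phi (J n w))%:E)%E @[n --> \oo] --> (\int[P]_w (phi (X w))%:E)%E.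
Proof.
move=> mJ mX cvgJ.
have iJ n := integrable_lipschitz01 (mJ n).
have iX := integrable_lipschitz01 mX.
have L0 : 0 <= L by have := phiL 1 0; rewrite subr0 normr1 mulr1; apply: le_trans.
have key (e : R) n : 0 < e ->
    (`|\int[P]_w (phi (J n w))%:E - \int[P]_w (phi (X w))%:E| <=
     e%:E + (L ^+ 2 / e)%:E * 'E_P[fun w => ((J n w - X w) ^+ 2)%R])%E.
  move=> e0.
  have mD : measurable_fun setT (fun w => (J n w - X w) ^+ 2).
    by apply: measurable_funX; exact: measurable_funB.
  rewrite -integralB//.
  apply: (@le_trans _ _ (\int[P]_w `|(phi (J n w) - phi (X w))%:E|)%E).
    by apply: le_abse_integral => //; apply: (measurable_int P); exact: integrableB.
  rewrite unlock -ge0_integralZl_EFin//; last 3 first.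
  - by move=> w _; rewrite lee_fin sqr_ge0.
  - exact/measurable_EFinP. 
  - by rewrite divr_ge0 ?sqr_ge0// ltW.
  have ee : (e%:E = \int[P]_w e%:E)%E by rewrite -[LHS](expectation_cst P e) unlock.
  rewrite [X in (_ <= X + _)%E]ee -ge0_integralD//; last 3 first.
  - by move=> w _; rewrite lee_fin ltW.
  - by move=> w _; rewrite lee_fin mulr_ge0 ?sqr_ge0// divr_ge0 ?sqr_ge0// ltW.
  - by apply/measurable_EFinP; apply: measurable_funM.
  apply: ge0_le_integral => //.
  - apply: measurableT_comp => //; apply/measurable_EFinP; apply: measurable_funB; exact: measurableT_comp.
  - apply: emeasurable_funD => //; by apply/measurable_EFinP; apply: measurable_funM.
  move=> w _ /=; rewrite lee_fin; apply: le_trans (phiL _ _) _.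
  rewrite -(ger0_norm (sqr_ge0 (J n w - X w))) normrX.
  move: `|J n w - X w| (normr_ge0 (J n w - X w)) => u u0.
  (* L u <= e + (L u)^2 / e *)
  have -> : L ^+ 2 / e * u ^+ 2 = (L * u) ^+ 2 / e by field; rewrite gt_eqF.
  have [y1|y1] := leP (L * u) e.
    by rewrite (le_trans y1)// lerDl divr_ge0 ?sqr_ge0// ltW.
  apply: (@le_trans _ _ ((L * u) ^+ 2 / e)); last by rewrite lerDr ltW.
  by rewrite ler_pdivlMr// expr2 ler_wpM2l ?mulr_ge0// ltW.
have finJ n := integrable_fin_num measurableT (iJ n).
have finX := integrable_fin_num measurableT iX.
have /fine_cvgP[finD cvgD] : 'E_P[fun w => ((J n w - X w) ^+ 2)%R]%E @[n --> \oo] --> (0 : R)%:E.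
  exact: cvgJ.
rewrite -(fineK finX); apply/fine_cvgP; split; first by near=> n; exact: finJ.
apply/cvgrPdist_le => e e0.
have e20 : 0 < e / 2 by lra.
have c0 : 0 <= L ^+ 2 / (e / 2) by rewrite divr_ge0 ?sqr_ge0// ltW.
near=> n.
have finDn : 'E_P[fun w => ((J n w - X w) ^+ 2)%R]%E \is a fin_num by near: n.
(* With c = L^2 / (e / 2), this makes c times the second moment at most e / 2; the added 1 covers c
   = 0. *)
have small : fine 'E_P[fun w => ((J n w - X w) ^+ 2)%R]%E <= (L ^+ 2 / (e / 2) + 1)^-1 * (e / 2).
  near: n; apply: (cvgr_le (0 : R)) => //.
  by rewrite mulr_gt0// invr_gt0; lra.
have := key (e / 2) n e20.
rewrite -(fineK (finJ n)) -(fineK finX) -(fineK finDn) -EFinB -EFinM -EFinD lee_fin /=.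
rewrite distrC => /le_trans; apply.
move: (fine _) (fine_ge0 (expectation_ge0 P (fun w => sqr_ge0 (J n w - X w)))) small => z z0.
move: (L ^+ 2 / (e / 2)) (c0) => c c1; rewrite ler_pdivlMl; last by lra.
by move=> h; nra.
Unshelve. all: by end_near. Qed.

Lemma gauss_L2_limit (J : nat -> T -> R) (X : T -> R) (v_ : nat -> R) (v : R) :
  (forall n, is_gaussian P (J n)) -> (forall n, 'E_P[J n]%E = 0%E) ->
  (forall n, 'E_P[fun w => (J n w ^+ 2)%R]%E = (v_ n)%:E) ->
  v_ @ \oo --> v -> 0 < v -> measurable_fun setT X ->
  'E_P[fun w => ((J n w - X w) ^+ 2)%R]%E @[n --> \oo] --> 0%E ->
  (\int[P]_w (phi (X w))%:E = \int[mu]_x (phi x * centered_gauss_pdf v x)%:E)%E.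
Proof.
move=> gJ EJ EJ2 vv v0 mX cvgJ.
have mJ n : measurable_fun setT (J n) by case: (gJ n).
have h1 := L2_cvg_expectation mJ mX cvgJ.
have h2 := cvg_centered_gauss_integral v0 vv mphi phi01.
suff h3 : (\int[P]_w (phi (J n w))%:E)%E @[n --> \oo] -->
    (\int[mu]_x (phi x * centered_gauss_pdf v x)%:E)%E by exact: (cvg_unique _ h1 h3).
apply: cvg_trans h2.
(* A degenerate [J n] has no density; as v > 0, that happens for finitely many n at most. *)
have vpos : \forall n \near \oo, 0 < v_ n by exact: (@cvgr_gt _ _ _ _ v_ v vv 0 v0).
apply: near_eq_cvg; near=> n.
have vn0 : 0 < v_ n by near: n.
have gd := centered_gauss_density (gJ n) (EJ n) (EJ2 n) vn0.
rewrite (ge0_integral_has_density gd (h := fun x => (phi x)%:E)).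
- by apply: eq_integral => x _; rewrite EFinM.
- exact/measurable_EFinP.
- by move=> x; rewrite lee_fin; have /andP[] := phi01 x.
Unshelve. all: by end_near. Qed.

End L2_limit.

(** * Moments of elementary integrals *)

Definition fBm_covariance (R : realType) (H t s : R) : R :=
  (t `^ (2 * H) + s `^ (2 * H) - `|t - s| `^ (2 * H)) / 2.

Definition step_variance (R : realType) (H : R) (s : seq (R * R)) : R :=
  \sum_(a <- s) \sum_(b <- s) a.1 * b.1 * fBm_covariance H a.2 b.2.

Section step_moments.
Context d (T : measurableType d) (R : realType) (P : probability T R).
Variables (H : R) (B : R -> T -> R).
Hypothesis fB : is_fBm P H B.

(* [integral_sum] requires integrability at every index: [B'] is square integrable
   at all times and coincides with B at the nonnegative ones. *)
Let B' (t : R) := B `|t|.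

Let mB t : measurable_fun setT (B' t).
Proof.
have [] := fBm_gaussian fB (s := [:: (1, `|t|)]); first by rewrite /= normr_ge0.
move=> mS _; suff -> : B' t = step_int B [:: (1, `|t|)] by [].
by apply/funext => w; rewrite /step_int big_seq1 /= mul1r.
Qed.

Let covB t s : (\int[P]_w (B' t w * B' s w)%:E)%E = (fBm_covariance H `|t| `|s|)%:E.
Proof. by have := fBm_cov fB (normr_ge0 s) (normr_ge0 t); rewrite unlock. Qed.

Let iB t : P.-integrable setT (EFin \o B' t).
Proof.
apply: (@integrable_of_sqr _ _ _ _ _ (fBm_covariance H `|t| `|t|)) => //.
rewrite unlock -covB; apply: eq_integral => w _; by rewrite expr2.
Qed.

Let iBB t s : P.-integrable setT (EFin \o (fun w => B' t w * B' s w)).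
Proof.
have i2 r : P.-integrable setT (EFin \o (fun w => B' r w * B' r w)).
  apply/integrableP; split; first by apply/measurable_EFinP; apply: measurable_funM.
  rewrite (_ : (\int[P]_x _)%E = (fBm_covariance H `|r| `|r|)%:E) ?ltry// -covB.
  by apply: eq_integral => w _ /=; rewrite ger0_norm// -expr2 sqr_ge0.
apply: (le_integrable measurableT _ _ (integrableD measurableT (i2 t) (i2 s))).
  by apply/measurable_EFinP; apply: measurable_funM.
move=> w _ /=; rewrite lee_fin -!expr2 [leRHS]ger0_norm ?addr_ge0 ?sqr_ge0//.
rewrite normrM -(ger0_norm (sqr_ge0 (B' t w))) -(ger0_norm (sqr_ge0 (B' s w))) !normrX.
move: `|B' t w| `|B' s w| (normr_ge0 (B' t w)) (normr_ge0 (B' s w)) => x y x0 y0.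
have := sqr_ge0 (x - y); nra.
Qed.

Variable s : seq (R * R).
Hypothesis s0 : all (fun a => 0 <= a.2) s.

Let step_intE w : step_int B s w = \sum_(a <- s) a.1 * B' a.2 w.
Proof.
rewrite /step_int big_seq [RHS]big_seq; apply: eq_bigr => a /(allP s0) a0.
by rewrite /B' ger0_norm.
Qed.

Lemma step_int_expectation : 'E_P[step_int B s]%E = 0%E.
Proof.
rewrite unlock; under eq_integral do rewrite step_intE -sumEFin.
rewrite integral_sum//; last first.
  by move=> a; under eq_fun do rewrite EFinM; exact: (integrableZl measurableT a.1 (iB a.2)).
rewrite big_seq big1// => a /(allP s0) a0.
under eq_integral do rewrite EFinM.
apply: etrans; first exact: (integralZl measurableT (iB a.2) a.1).
rewrite [X in (_ * X)%E](_ : _ = 0%E) ?mule0//.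
by have := fBm_centered fB a0; rewrite unlock /B' ger0_norm.
Qed.

Lemma step_int_variance :
  'E_P[fun w => (step_int B s w ^+ 2)%R]%E = (step_variance H s)%:E.
Proof.
rewrite unlock.
under eq_integral.
  move=> w _; rewrite step_intE expr2 big_distrlr/= -sumEFin.
  under eq_bigr do rewrite -sumEFin.
  over.
have iab a b : P.-integrable setT (fun w => (a.1 * B' a.2 w * (b.1 * B' b.2 w))%:E).
  under eq_fun do rewrite mulrACA EFinM.
  exact: (integrableZl measurableT (a.1 * b.1) (iBB a.2 b.2)).
rewrite integral_sum//; last first.
  by move=> a; apply: integrable_sum.
rewrite /step_variance -sumEFin big_seq [RHS]big_seq; apply: eq_bigr => a /(allP s0) a0.
rewrite integral_sum// -sumEFin big_seq [RHS]big_seq; apply: eq_bigr => b /(allP s0) b0.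
under eq_integral do rewrite mulrACA EFinM.
apply: etrans; first exact: (integralZl measurableT (iBB a.2 b.2) (a.1 * b.1)).
by rewrite /= covB !ger0_norm.
Qed.

End step_moments.

(** * Tonelli's theorem on rectangles *)

Section iterated.
Context {R : realType}.
Notation mu := (@lebesgue_measure R).
Notation leb2 := (mu \x mu)%E.

Let measurable_rectangle_integrand (A B : set R) (h : R * R -> R) :
  measurable A -> measurable B -> measurable_fun setT h ->
  measurable_fun setT (fun z : R * R => (\1_A z.1 * \1_B z.2 * h z)%:E).
Proof.
move=> mA mB mh; apply/measurable_EFinP; apply: measurable_funM => //.
apply: measurable_funM.
  by apply: (@measurableT_comp _ _ _ _ _ _ (\1_A : R -> R)) => //; exact: measurable_indic.
by apply: (@measurableT_comp _ _ _ _ _ _ (\1_B : R -> R)) => //; exact: measurable_indic.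
Qed.

Lemma integral_rectangle1 (A B : set R) (h : R * R -> R) :
  measurable A -> measurable B -> measurable_fun setT h -> (forall z, 0 <= h z) ->
  (\int[leb2]_z (\1_A z.1 * \1_B z.2 * h z)%:E =
   \int[mu]_(u in A) \int[mu]_(v in B) (h (u, v))%:E)%E.
Proof.
move=> mA mB mh h0.
have mF := measurable_rectangle_integrand mA mB mh.
have F0 z : (0 <= (\1_A z.1 * \1_B z.2 * h z)%:E)%E by rewrite lee_fin mulr_ge0.
apply: etrans; first exact: (fubini_tonelli1 (m1 := mu) (m2 := mu) _ mF F0).
rewrite [RHS]integral_mkcond; apply: eq_integral => u _.
rewrite /fubini_F patchE; case: ifPn => uA.
  rewrite [RHS]integral_mkcond; apply: eq_integral => v _.
  by rewrite patchE !indicE/= uA mul1r; case: ifPn => _; rewrite ?mul1r ?mul0r.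
by rewrite integral0_eq// => v _; rewrite !indicE/= (negbTE uA) !mul0r.
Qed.

Lemma integral_rectangle2 (A B : set R) (h : R * R -> R) :
  measurable A -> measurable B -> measurable_fun setT h -> (forall z, 0 <= h z) ->
  (\int[leb2]_z (\1_A z.1 * \1_B z.2 * h z)%:E =
   \int[mu]_(v in B) \int[mu]_(u in A) (h (u, v))%:E)%E.
Proof.
move=> mA mB mh h0.
have mF := measurable_rectangle_integrand mA mB mh.
have F0 z : (0 <= (\1_A z.1 * \1_B z.2 * h z)%:E)%E by rewrite lee_fin mulr_ge0.
apply: etrans; first exact: (fubini_tonelli2 (m1 := mu) (m2 := mu) _ mF F0).
rewrite [RHS]integral_mkcond; apply: eq_integral => v _.
rewrite /fubini_G patchE; case: ifPn => vB.
  rewrite [RHS]integral_mkcond; apply: eq_integral => u _.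
  by rewrite patchE !indicE/= vB mulr1; case: ifPn => _; rewrite ?mul1r ?mul0r.
by rewrite integral0_eq// => u _; rewrite !indicE/= (negbTE vB) mulr0 mul0r.
Qed.

Lemma measurable_integral_section (B : set R) (g : R * R -> R) :
  measurable B -> measurable_fun setT g -> (forall z, 0 <= g z) ->
  measurable_fun setT (fun u => \int[mu]_(v in B) (g (u, v))%:E)%E.
Proof.
move=> mB mg g0.
have := @measurable_fun_fubini_tonelli_F _ _ _ _ R mu (fun z => (\1_B z.2 * g z)%:E).
have -> : fubini_F mu (fun z => (\1_B z.2 * g z)%:E) = (fun u => \int[mu]_(v in B) (g (u, v))%:E)%E.
  apply/funext => u; rewrite /fubini_F [RHS]integral_mkcond; apply: eq_integral => v _.
  by rewrite patchE indicE/=; case: ifPn => _; rewrite ?mul1r ?mul0r.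
apply; last by move=> z; rewrite lee_fin mulr_ge0.
apply/measurable_EFinP; apply: measurable_funM => //.
by apply: (@measurableT_comp _ _ _ _ _ _ (\1_B : R -> R)) => //; exact: measurable_indic.
Qed.

End iterated.

Lemma hurst_const_gt0 (R : realType) (H : R) : 1 / 2 < H -> 0 < H * (2 * H - 1).
Proof. by move=> h; apply: mulr_gt0; lra. Qed.

(** * The quadratic form of the kernel and its continuity *)

Section kernel_form.
Context {R : realType}.
Notation mu := (@lebesgue_measure R).
Notation leb2 := (mu \x mu)%E.
Variables (H t : R).
Hypotheses (H_gt : 1 / 2 < H) (H_lt : H < 1) (t0 : 0 <= t).
Let D : set R := `[0, t]%classic.
Let k (z : R * R) : R := `|z.1 - z.2| `^ (2 * H - 2).
(* The kernel cut off outside [0, t]^2, so that integrals range over the plane. *)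
Let w (z : R * R) : R := \1_D z.1 * \1_D z.2 * k z.
Local Notation cH := (H * (2 * H - 1)).

Let cH0 : 0 < cH. Proof. exact: hurst_const_gt0. Qed.
Let mD : measurable D. Proof. exact: measurable_itv. Qed.

Let mk : measurable_fun setT k.
Proof.
apply: (@measurableT_comp _ _ _ _ _ _ (fun x : R => `|x| `^ (2 * H - 2))).
  exact: measurable_norm_powR.
by apply: measurable_funB => //; exact: measurable_snd.
Qed.

Let k0 z : 0 <= k z. Proof. exact: powR_ge0. Qed.

Let m1 (A : set R) : measurable A -> measurable_fun setT (fun z : R * R => \1_A z.1 : R).
Proof.
by move=> mA; apply: (@measurableT_comp _ _ _ _ _ _ (\1_A : R -> R)) => //; exact: measurable_indic.
Qed.

Let m2 (A : set R) : measurable A -> measurable_fun setT (fun z : R * R => \1_A z.2 : R).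
Proof.
by move=> mA; apply: (@measurableT_comp _ _ _ _ _ _ (\1_A : R -> R)) => //; exact: measurable_indic.
Qed.

Let mw : measurable_fun setT w.
Proof. by apply: measurable_funM => //; apply: measurable_funM; [exact: m1|exact: m2]. Qed.

Let w0 z : 0 <= w z. Proof. by rewrite !mulr_ge0. Qed.

Let iterated1 (g : R * R -> R) : measurable_fun setT g -> (forall z, 0 <= g z) ->
  (\int[leb2]_z (g z * w z)%:E =
   \int[mu]_(u in D) \int[mu]_(v in D) (g (u, v) * `|u - v| `^ (2 * H - 2))%:E)%E.
Proof.
move=> mg g0; rewrite -(integral_rectangle1 (h := fun z => g z * k z))//; last 2 first.
- exact: measurable_funM.
- by move=> z; rewrite mulr_ge0.
by apply: eq_integral => z _; congr EFin; rewrite /w; ring.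
Qed.

(** The closed form of [integral_kernel2] with b = 2H - 1 is the covariance over [cH]; the cutoff in
    [w] changes nothing on a rectangle inside [[0, t]^2]. *)
Let integral_w_rect (r s : R) : 0 <= r <= t -> 0 <= s <= t ->
  (\int[leb2]_z ((\1_(`[0%R, r]%classic) z.1 * \1_(`[0%R, s]%classic) z.2) * w z)%:E)%E =
  (fBm_covariance H r s / cH)%:E.
Proof.
move=> /andP[r0 rt] /andP[s0 st].
have sub x : x <= t -> `[0, x]%classic `<=` D.
  by move=> xt y; rewrite /D/= !in_itv/= => /andP[-> /le_trans]; exact.
transitivity (\int[leb2]_z (\1_(`[0%R, r]%classic) z.1 * \1_(`[0%R, s]%classic) z.2 * k z)%:E)%E.
  apply: eq_integral => z _; congr EFin; rewrite /w !indicE.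
  have [z1|] := boolP (z.1 \in `[0, r]%classic); last by rewrite !mul0r.
  have [z2|] := boolP (z.2 \in `[0, s]%classic); last by rewrite !mulr0 !mul0r.
  have -> : z.1 \in D by rewrite inE; apply: (sub r) => //; rewrite inE in z1.
  have -> : z.2 \in D by rewrite inE; apply: (sub s) => //; rewrite inE in z2.
  by rewrite !mul1r.
rewrite integral_rectangle1// /k.
have e : 2 * H - 2 = (2 * H - 1) - 1 by ring.
rewrite e integral_kernel2//; last by have := H_gt; lra.
congr EFin; rewrite /fBm_covariance (_ : 2 * H - 1 + 1 = 2 * H); last by ring.
by have := H_gt => h; field; rewrite !gt_eqF//; lra.
Qed.

Let integrable_w : leb2.-integrable setT (EFin \o w).
Proof.
apply/integrableP; split; first exact/measurable_EFinP.
have tt : 0 <= t <= t by rewrite t0 lexx.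
rewrite (_ : (\int[leb2]_x _)%E = (fBm_covariance H t t / cH)%:E) ?ltry//.
rewrite -(integral_w_rect tt tt); apply: eq_integral => z _ /=.
rewrite ger0_norm//; congr EFin; rewrite /w -/D mulrA !mulrA.
by rewrite !indicE; do 2 case: (_ \in D); rewrite ?mul1r ?mul0r ?mulr0 ?mulr1 ?mul0r.
Qed.

Let integrable_bounded_w (g : R * R -> R) (C : R) : measurable_fun setT g ->
  (forall z, D z.1 -> D z.2 -> `|g z| <= C) ->
  leb2.-integrable setT (fun z => (g z * w z)%:E).
Proof.
move=> mg gC.
apply: (le_integrable measurableT _ _ (integrableZl measurableT C integrable_w)).
  by apply/measurable_EFinP; exact: measurable_funM.
move=> z _ /=; rewrite lee_fin [leLHS]normrM [leRHS]normrM (ger0_norm (w0 z)).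
have [z1|z1] := pselect (D z.1); last first.
  by rewrite /w indicE memNset// !mul0r !mulr0.
have [z2|z2] := pselect (D z.2); last first.
  by rewrite /w [X in _ * X * _]indicE memNset// mulr0 !mul0r !mulr0.
by rewrite ler_wpM2r// (le_trans (gC _ z1 z2))// ler_norm.
Qed.

Lemma measurable_step_fun (s : seq (R * R)) : measurable_fun setT (step_fun s).
Proof.
by apply: measurable_sum => a; apply: measurable_funM => //; exact: measurable_indic.
Qed.

Lemma step_fun_bounded (s : seq (R * R)) u : `|step_fun s u| <= \sum_(a <- s) `|a.1|.
Proof.
apply: le_trans (ler_norm_sum _ _ _) _; apply: ler_sum => a _.
by rewrite normrM ler_piMr// indicE; case: (_ \in _); rewrite ?normr1 ?normr0.
Qed.

(** The isometry on elementary integrands: by bilinearity, the pairs of indicators in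
    [integral_w_rect] suffice. *)
Let step_variance_form (s : seq (R * R)) : all (fun a => 0 <= a.2 <= t) s ->
  (\int[leb2]_z (step_fun s z.1 * step_fun s z.2 * w z)%:E)%E =
  (step_variance H s / cH)%:E.
Proof.
move=> /allP st.
pose I a b (z : R * R) : R := \1_(`[0, a]%classic) z.1 * \1_(`[0, b]%classic) z.2.
have iI a b : leb2.-integrable setT (fun z => (I a b z * w z)%:E).
  apply: (integrable_bounded_w (C := 1)).
    by apply: measurable_funM; [exact: m1|exact: m2].
  by move=> z _ _; rewrite /I !indicE; do 2 case: (_ \in _); rewrite ?mul0r ?mulr0 ?mulr1 ?normr1 ?normr0.
transitivity (\int[leb2]_z \sum_(a <- s) \sum_(b <- s) ((a.1 * b.1)%:E * (I a.2 b.2 z * w z)%:E))%E.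
  apply: eq_integral => z _; rewrite /step_fun big_distrlr/= mulr_suml -sumEFin.
  apply: eq_bigr => a _; rewrite mulr_suml -sumEFin; apply: eq_bigr => b _.
  by rewrite -EFinM; congr EFin; rewrite /I; ring.
have iab a b : leb2.-integrable setT (fun z => (a.1 * b.1)%:E * (I a.2 b.2 z * w z)%:E)%E.
  exact: integrableZl.
rewrite integral_sum//; last by move=> a; apply: integrable_sum.
rewrite /step_variance mulr_suml -sumEFin big_seq [RHS]big_seq; apply: eq_bigr => a /st sa.
rewrite integral_sum// mulr_suml -sumEFin big_seq [RHS]big_seq; apply: eq_bigr => b /st sb.
by rewrite integralZl// integral_w_rect// -EFinM mulrA.
Qed.

(** Both boundary terms of [integral_kernel1] are at most t^(2H-1), since u and t - u lie in
    [[0, t]]. Uniformity in u is what lets an L^1 norm control the cross terms of the form. *)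
Let inner_le (u : R) : D u ->
  (\int[mu]_(v in D) (`|u - v| `^ (2 * H - 2))%:E <= (2 * t `^ (2 * H - 1) / (2 * H - 1))%:E)%E.
Proof.
have b0 : 0 < 2 * H - 1 by have := H_gt; lra.
rewrite /D /= in_itv/= => /andP[u0 ut].
have -> : 2 * H - 2 = (2 * H - 1) - 1 by ring.
rewrite integral_kernel1// lee_fin subr0.
have ub x : `|x| <= t -> Num.sg x * `|x| `^ (2 * H - 1) <= t `^ (2 * H - 1).
  move=> xt; apply: (@le_trans _ _ (`|x| `^ (2 * H - 1))).
    rewrite ler_piMl ?powR_ge0//.
    by rewrite (le_trans (ler_norm _))// normr_sg; case: (_ == _).
  by rewrite ge0_ler_powR ?nnegrE ?normr_ge0// ltW.
have h1 : Num.sg u * `|u| `^ (2 * H - 1) <= t `^ (2 * H - 1) by apply: ub; rewrite ger0_norm.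
have h2 : - (Num.sg (u - t) * `|u - t| `^ (2 * H - 1)) <= t `^ (2 * H - 1).
  rewrite -mulNr -sgrN -(normrN (u - t)) opprB.
  by apply: ub; rewrite ger0_norm; lra.
rewrite -mulrBr mulrC ler_pM2r ?invr_gt0//.
by apply: le_trans (lerD h1 h2) _; lra.
Qed.

Section convergence.
Variables (f : R -> R) (M0 : R) (s : nat -> seq (R * R)).
Hypotheses (t_gt0 : 0 < t) (mf : measurable_fun setT f) (f0 : forall u, 0 <= f u)
  (fM : forall u, D u -> f u <= M0) (st : forall n, all (fun a => 0 <= a.2 <= t) (s n)).
Let h n u := step_fun (s n) u - f u.

Let mh n : measurable_fun setT (h n).
Proof. by apply: measurable_funB => //; exact: measurable_step_fun. Qed.

Let mhE n B : measurable_fun B (fun u => `|h n u|%:E).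
Proof.
apply/measurable_EFinP; apply: measurable_funTS.
exact: (measurableT_comp (@normr_measurable R setT) (mh n)).
Qed.

Let mh1 n : measurable_fun setT (fun z : R * R => `|h n z.1|).
Proof.
apply: measurableT_comp => //; apply: (@measurableT_comp _ _ _ _ _ _ (h n)) => //.
Qed.

Let mh2 n : measurable_fun setT (fun z : R * R => `|h n z.2|).
Proof.
apply: measurableT_comp => //; apply: (@measurableT_comp _ _ _ _ _ _ (h n)) => //.
Qed.

(** Depends on n through the coefficients of [s n], hence serves only integrability; the estimates
    uniform in n use [M0]. *)
Let C n := \sum_(a <- s n) `|a.1| + M0.

Let hC n u : D u -> `|h n u| <= C n.
Proof.
move=> Du; apply: le_trans (ler_normB _ _) _.
by rewrite lerD ?step_fun_bounded// ger0_norm// fM.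
Qed.

Let C0 n : 0 <= C n.
Proof. by apply: le_trans (hC n (u := 0) _) => //; rewrite /D/= in_itv/= lexx t0. Qed.

(** Up to the factor [cH], this is [abs_norm2 H t (h n)] written as an integral over the plane. *)
Let A n := (\int[leb2]_z (`|h n z.1| * `|h n z.2| * w z)%:E)%E.
Let l n := (\int[mu]_(u in D) `|h n u|%:E)%E.

Let iA n : leb2.-integrable setT (fun z => (`|h n z.1| * `|h n z.2| * w z)%:E).
Proof.
apply: (integrable_bounded_w (C := C n * C n)); first exact: measurable_funM.
by move=> z z1 z2; rewrite normrM !normr_id ler_pM// hC.
Qed.

Let l_fin n : l n \is a fin_num.
Proof.
apply: integrable_fin_num => //.
apply: (@measurable_bounded_integrable _ _ _ mu (fun u => `|h n u|)) => //.
- by apply: compact_finite_measure; exact: segment_compact.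
- apply: measurable_funTS; exact: (measurableT_comp (@normr_measurable R setT) (mh n)).
- exists (C n); split; rewrite ?num_real// => x Cx u Du /=.
  by rewrite normr_id (le_trans (hC n Du))// ltW.
Qed.

Let l_ge0 n : (0 <= l n)%E.
Proof. by apply: integral_ge0 => u _; rewrite lee_fin. Qed.

(* On [0, t]^2 the kernel is at least t^(2H-2), except on the diagonal, where
   [powR] gives 0: the point u is removed from the inner integral. *)
Let l2_le n : ((t `^ (2 * H - 2))%:E * (l n * l n) <= A n)%E.
Proof.
rewrite /A iterated1//; last by apply: measurable_funM.
have c0 : (0 <= (t `^ (2 * H - 2))%:E * l n)%E by rewrite mule_ge0// lee_fin powR_ge0.
have -> : ((t `^ (2 * H - 2))%:E * (l n * l n) =
    \int[mu]_(u in D) (((t `^ (2 * H - 2))%:E * l n) * `|h n u|%:E))%E.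
  by rewrite ge0_integralZl//; [rewrite muleA|exact: mhE].
apply: ge0_le_integral => //.
- by move=> u _; rewrite mule_ge0// lee_fin.
- by apply: emeasurable_funM => //; exact: mhE.
- apply: measurable_funTS.
  apply: (measurable_integral_section (g := fun z => `|h n z.1| * `|h n z.2| * k z)) => //.
  + by apply: measurable_funM => //; exact: measurable_funM.
  + by move=> z; rewrite !mulr_ge0.
move=> u Du.
have mDu : measurable (D `\ u) by exact: measurableD.
have mprod B : measurable_fun B (fun v => (`|h n u| * `|h n v| * `|u - v| `^ (2 * H - 2))%:E).
  apply/measurable_EFinP; apply: measurable_funTS; apply: measurable_funM.
    apply: measurable_funM; first exact: measurable_cst.
    exact: (measurableT_comp (@normr_measurable R setT) (mh n)).
  apply: (measurableT_comp (measurable_norm_powR (2 * H - 2))).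
  by apply: measurable_funB => //; exact: measurable_cst.
rewrite -(@integral_setD1 _ (fun v => (`|h n u| * `|h n v| * `|u - v| `^ (2 * H - 2))%:E) u)//.
have -> : ((t `^ (2 * H - 2))%:E * l n * `|h n u|%:E =
    \int[mu]_(v in D `\ u) ((t `^ (2 * H - 2) * `|h n u|)%:E * `|h n v|%:E))%E.
  rewrite ge0_integralZl//; last 2 first.
  - exact: mhE.
  - by rewrite lee_fin mulr_ge0// powR_ge0.
  rewrite (@integral_setD1 _ (fun v => `|h n v|%:E) u)//.
  by rewrite muleAC EFinM.
apply: ge0_le_integral => //.
- by move=> v _; rewrite mule_ge0// lee_fin mulr_ge0// powR_ge0.
- by apply: emeasurable_funM => //; exact: mhE.
- exact: mprod.
move=> v [Dv /= vu]; rewrite -EFinM lee_fin.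
rewrite [leRHS](_ : _ = (`|u - v| `^ (2 * H - 2) * `|h n u|) * `|h n v|); last by ring.
rewrite ler_wpM2r// ler_wpM2r//.
have uv0 : 0 < `|u - v| by rewrite normr_gt0 subr_eq0; apply/eqP => e; exact/vu.
(* Raising to the negative power 2H - 2 reverses |u - v| <= t. *)
have -> : 2 * H - 2 = - (2 - 2 * H) by ring.
rewrite !powRN lef_pV2 ?posrE ?powR_gt0// ge0_ler_powR ?nnegrE//.
- by have := H_lt; lra.
- by move: Du Dv; rewrite /D/= !in_itv/= => /andP[? ?] /andP[? ?]; rewrite ler_norml; lra.
Qed.

(** With a single factor h, the kernel can be integrated out in the other variable, where [inner_le]
    bounds it. *)
Let iterate_fst n : (\int[leb2]_z (`|h n z.1| * w z)%:E <=
   (2 * t `^ (2 * H - 1) / (2 * H - 1))%:E * l n)%E.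
Proof.
have K0 : 0 <= 2 * t `^ (2 * H - 1) / (2 * H - 1).
  by rewrite divr_ge0 ?mulr_ge0 ?powR_ge0//; have := H_gt; lra.
rewrite iterated1//.
rewrite -ge0_integralZl//; last exact: mhE.
apply: ge0_le_integral => //.
- by move=> u _; apply: integral_ge0 => v _; rewrite lee_fin mulr_ge0 ?powR_ge0.
- apply: measurable_funTS.
  apply: (measurable_integral_section (g := fun z => `|h n z.1| * k z)) => //.
  + by apply: measurable_funM => //.
  + by move=> z; rewrite !mulr_ge0.
- by apply: emeasurable_funM => //; exact: mhE.
move=> u Du.
rewrite [leLHS](_ : _ = (`|h n u|%:E * \int[mu]_(v in D) (`|u - v| `^ (2 * H - 2))%:E)%E).
  by rewrite muleC; apply: lee_wpmul2r; [rewrite lee_fin|exact: inner_le].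
rewrite -ge0_integralZl_EFin//.
apply/measurable_EFinP; apply: measurable_funTS.
  apply: (measurableT_comp (measurable_norm_powR (2 * H - 2))).
  by apply: measurable_funB => //; exact: measurable_cst.
Qed.

Let iterate_snd n : (\int[leb2]_z (`|h n z.2| * w z)%:E <=
   (2 * t `^ (2 * H - 1) / (2 * H - 1))%:E * l n)%E.
Proof.
rewrite (_ : (\int[leb2]_z (`|h n z.2| * w z)%:E = \int[leb2]_z (`|h n z.1| * w z)%:E)%E); first exact: iterate_fst.
have mhk : measurable_fun setT (fun z => `|h n z.2| * k z) by exact: measurable_funM.
have hk0 z : 0 <= `|h n z.2| * k z by rewrite mulr_ge0.
have e := integral_rectangle2 mD mD mhk hk0.
transitivity (\int[leb2]_z (\1_D z.1 * \1_D z.2 * (`|h n z.2| * k z))%:E)%E.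
  by apply: eq_integral => z _; congr EFin; rewrite /w; ring.
have e2 := iterated1 (mh1 n) (fun z => normr_ge0 (h n z.1)).
apply: etrans; first exact: e.
apply: etrans; last exact/esym/e2.
by apply: eq_integral => u _; apply: eq_integral => v _ /=; rewrite /k/= (distrC v u).
Qed.

Let M0_ge0 : 0 <= M0.
Proof. by apply: le_trans (f0 0) (fM _); rewrite /D/= in_itv/= lexx t0. Qed.

Let mf1 : measurable_fun setT (fun z : R * R => f z.1).
Proof. exact: (@measurableT_comp _ _ _ _ _ _ f). Qed.

Let mf2 : measurable_fun setT (fun z : R * R => f z.2).
Proof. exact: (@measurableT_comp _ _ _ _ _ _ f). Qed.

Let ms1 n : measurable_fun setT (fun z : R * R => step_fun (s n) z.1).
Proof. by apply: (@measurableT_comp _ _ _ _ _ _ (step_fun (s n))) => //; exact: measurable_step_fun. Qed.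

Let ms2 n : measurable_fun setT (fun z : R * R => step_fun (s n) z.2).
Proof. by apply: (@measurableT_comp _ _ _ _ _ _ (step_fun (s n))) => //; exact: measurable_step_fun. Qed.

Let integrable_ff : leb2.-integrable setT (fun z => (f z.1 * f z.2 * w z)%:E).
Proof.
apply: (integrable_bounded_w (C := M0 * M0)); first exact: measurable_funM.
by move=> z z1 z2; rewrite normrM !ger0_norm// ler_pM// fM.
Qed.

(** Of the three terms of the expansion around f, the one quadratic in h is bounded by [A n]; each
    of the two linear ones contains a factor f <= M0 and falls under [iterate_fst] or
    [iterate_snd]. *)
Let form_dist n :
  (`|(step_variance H (s n) / cH)%:E - \int[leb2]_z (f z.1 * f z.2 * w z)%:E| <=
   A n + (2 * M0 * (2 * t `^ (2 * H - 1) / (2 * H - 1)))%:E * l n)%E.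
Proof.
have mss : measurable_fun setT (fun z : R * R => step_fun (s n) z.1 * step_fun (s n) z.2) by exact: measurable_funM.
have mff : measurable_fun setT (fun z : R * R => f z.1 * f z.2) by exact: measurable_funM.
rewrite -(step_variance_form (st n)) -integralB//; last first.
  apply: (integrable_bounded_w (C := (\sum_(a <- s n) `|a.1|) * (\sum_(a <- s n) `|a.1|))).
    exact: measurable_funM.
  by move=> z z1 z2; rewrite normrM ler_pM// step_fun_bounded.
apply: le_trans (le_abse_integral _ _ _) _ => //.
  by apply/measurable_EFinP; exact: (measurable_funB (measurable_funM mss mw) (measurable_funM mff mw)).
have iz1 : leb2.-integrable setT (fun z => (`|h n z.1| * w z)%:E).
  by apply: (integrable_bounded_w (C := C n)) => // z z1 z2; rewrite normr_id hC.
have iz2 : leb2.-integrable setT (fun z => (`|h n z.2| * w z)%:E).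
  by apply: (integrable_bounded_w (C := C n)) => // z z1 z2; rewrite normr_id hC.
have m3 (g : R * R -> R) : measurable_fun setT g -> measurable_fun setT (fun z => (g z * w z)%:E).
  by move=> mg; apply/measurable_EFinP; exact: measurable_funM.
apply: (@le_trans _ _ (\int[leb2]_z ((`|h n z.1| * `|h n z.2| * w z)%:E +
    (M0%:E * (`|h n z.1| * w z)%:E + M0%:E * (`|h n z.2| * w z)%:E)))%E).
  apply: ge0_le_integral => //.
  - apply: measurableT_comp => //; apply/measurable_EFinP.
    exact: (measurable_funB (measurable_funM mss mw) (measurable_funM mff mw)).
  - apply: emeasurable_funD; first by apply: m3; exact: measurable_funM.
    by apply: emeasurable_funD; apply: emeasurable_funM => //; exact: m3.
  move=> z _ /=; rewrite -!EFinM -!EFinD lee_fin -mulrBl normrM (ger0_norm (w0 z)).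
  have [z1|z1] := pselect (D z.1); last first.
    suff -> : w z = 0 by rewrite !mulr0 !addr0.
    by rewrite /w indicE memNset// !mul0r.
  have [z2|z2] := pselect (D z.2); last first.
    suff -> : w z = 0 by rewrite !mulr0 !addr0.
    by rewrite /w [X in _ * X * _]indicE memNset// mulr0 !mul0r.
  move: (w z) (w0 z) => W W0.
  rewrite !(mulrA M0) -!mulrDl ler_wpM2r//.
  (* s s' - f f' = h h' + (h f' + h' f) for h = s - f *)
  have -> : step_fun (s n) z.1 * step_fun (s n) z.2 - f z.1 * f z.2 =
    h n z.1 * h n z.2 + (h n z.1 * f z.2 + h n z.2 * f z.1) by rewrite /h; ring.
  apply: le_trans (ler_normD _ _) _; rewrite normrM lerD2l.
  apply: le_trans (ler_normD _ _) _; rewrite !normrM !(ger0_norm (f0 _)).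
  by rewrite lerD// mulrC ler_wpM2r// fM.
rewrite ge0_integralD//; last 4 first.
- by move=> z _; rewrite lee_fin !mulr_ge0.
- by apply: m3; exact: measurable_funM.
- by move=> z _; rewrite adde_ge0// mule_ge0// lee_fin mulr_ge0.
- by apply: emeasurable_funD; apply: emeasurable_funM => //; exact: m3.
rewrite leeD2l// ge0_integralD//; last 4 first.
- by move=> z _; rewrite mule_ge0// lee_fin mulr_ge0.
- by apply: emeasurable_funM => //; exact: m3.
- by move=> z _; rewrite mule_ge0// lee_fin mulr_ge0.
- by apply: emeasurable_funM => //; exact: m3.
rewrite !integralZl//.
apply: (@le_trans _ _ (M0%:E * ((2 * t `^ (2 * H - 1) / (2 * H - 1))%:E * l n) +
   M0%:E * ((2 * t `^ (2 * H - 1) / (2 * H - 1))%:E * l n))%E).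
  apply: leeD.
    by apply: lee_wpmul2l; [rewrite lee_fin|exact: iterate_fst].
  by apply: lee_wpmul2l; [rewrite lee_fin|exact: iterate_snd].
move: (2 * t `^ (2 * H - 1) / (2 * H - 1)) => K.
rewrite -(fineK (l_fin n)) -!EFinM -EFinD lee_fin le_eqVlt; apply/orP; left; apply/eqP; ring.
Qed.

Lemma step_variance_cvg :
  abs_norm2 H t (fun u => step_fun (s n) u - f u) @[n --> \oo] --> 0%E ->
  step_variance H (s n) @[n --> \oo] -->
  cH * fine (\int[mu]_(u in D) \int[mu]_(v in D)
    (f u * f v * `|u - v| `^ (2 * H - 2))%:E)%E.
Proof.
have -> : (fun n => abs_norm2 H t (fun u => step_fun (s n) u - f u)) =
    (fun n => cH%:E * A n)%E.
  by apply/funext => n; rewrite /A iterated1//; apply: measurable_funM.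
move=> cvgA.
have finA n : A n \is a fin_num by apply: integrable_fin_num.
have cA : fine (A n) @[n --> \oo] --> (0 : R).
  have /fine_cvgP[_ hh] : (cH%:E * A n)%E @[n --> \oo] --> (0 : R)%:E by exact: cvgA.
  have hh2 : cH^-1 * fine (cH%:E * A n)%E @[n --> \oo] --> (0 : R).
    by rewrite -(mulr0 cH^-1); apply: cvgM hh; exact: cvg_cst.
  have -> : (fun n => fine (A n)) = (fun n => cH^-1 * fine (cH%:E * A n)%E).
    by apply/funext => n; rewrite -(fineK (finA n)) -EFinM /= mulKf// gt_eqF.
  exact: hh2.
(* [l2_le] gives l n <= sqrt(A n / t^(2H-2)); t > 0 makes the divisor positive. *)
have cl : fine (l n) @[n --> \oo] --> (0 : R).
  have tp : 0 < t `^ (2 * H - 2) by rewrite powR_gt0.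
  apply: (@squeeze_cvgr _ _ _ _ (cst 0) (fun n => Num.sqrt (fine (A n) / t `^ (2 * H - 2)))).
  - near=> n; rewrite fine_ge0//= -[leLHS]ger0_norm ?fine_ge0// -sqrtr_sqr ler_sqrt; last first.
      rewrite divr_ge0 ?powR_ge0// fine_ge0//; apply: integral_ge0 => z _.
      by rewrite lee_fin !mulr_ge0.
    rewrite ler_pdivlMr// mulrC.
    by have := l2_le n; rewrite -(fineK (l_fin n)) -(fineK (finA n)) -!EFinM lee_fin expr2.
  - exact: cvg_cst.
  - rewrite -[X in _ --> X](@sqrtr0 R); apply: continuous_cvg; first exact: sqrt_continuous.
    by rewrite -(mul0r (t `^ (2 * H - 2))^-1); apply: cvgM => //; exact: cvg_cst.
have mff : measurable_fun setT (fun z : R * R => f z.1 * f z.2) by exact: measurable_funM.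
pose Q := (\int[leb2]_z (f z.1 * f z.2 * w z)%:E)%E.
have eQ : Q = (\int[mu]_(u in D) \int[mu]_(v in D) (f u * f v * `|u - v| `^ (2 * H - 2))%:E)%E.
  by apply: iterated1 => // z; rewrite mulr_ge0.
rewrite -eQ.
have Qfin : Q \is a fin_num by exact: integrable_fin_num.
have -> : (fun n => step_variance H (s n)) = (fun n => cH * (step_variance H (s n) / cH)).
  by apply/funext => n; rewrite mulrC divfK// gt_eqF.
apply: cvgM; first exact: cvg_cst.
set K := 2 * M0 * (2 * t `^ (2 * H - 1) / (2 * H - 1)).
apply/cvgrPdist_le => e e0.
have cAl : fine (A n) + K * fine (l n) @[n --> \oo] --> (0 : R).
  rewrite -[X in _ --> X](addr0 (0 : R)) -[X in _ --> _ + X](mulr0 K).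
  by apply: cvgD => //; apply: cvgM => //; exact: cvg_cst.
near=> n.
rewrite distrC; apply: (@le_trans _ _ (fine (A n) + K * fine (l n))).
  have := form_dist n; rewrite -/Q -/K -(fineK Qfin) -(fineK (finA n)) -(fineK (l_fin n)).
  by rewrite -EFinB -EFinM -EFinD lee_fin.
by near: n; exact: (cvgr_le (0 : R)).
Unshelve. all: by end_near. Qed.

End convergence.
End kernel_form.

(** * The substitution u = t - theta s *)

Section reflection.
Context {R : realType}.
Notation mu := (@lebesgue_measure R).
Variables (theta t : R).
Hypothesis theta_gt0 : 0 < theta.

Let phi (s : measurableTypeR R) : measurableTypeR R := t - theta * s.

Let mphi : measurable_fun setT phi.
Proof.
have h : measurable_fun setT (fun s : R => t - theta * s).
  by apply: measurable_funB => //; exact: measurable_funM.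
exact: h.
Qed.

Let nu : {measure set (measurableTypeR R) -> \bar R} :=
  mscale (NngNum (ltW theta_gt0)) (image_measure mu mphi).

Let nuE A : measurable A -> mu A = nu A.
Proof.
apply: lebesgue_measure_unique => _ [[a b] _ <-] /=.
rewrite /nu /mscale /=.
(* The map reverses orientation, so that the preimage of a left-open interval is right-open. *)
pose I : set R := `[(t - b) / theta, (t - a) / theta[%classic.
transitivity (theta%:E * mu I)%E.
  rewrite /I !lebesgue_measure_itv/= !lte_fin ltr_pM2r ?invr_gt0// ltrD2l ltrN2.
  case: ifP => ab; last by rewrite mule0.
  rewrite -!EFinB -EFinM; congr EFin; field; by have := theta_gt0; lra.
congr (_ * mu _)%E; apply/seteqP; split => x; rewrite /I /phi/= !in_itv/=.
  by rewrite ler_pdivrMr// ltr_pdivlMr// (mulrC x) => /andP[h1 h2]; apply/andP; split; lra.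
by rewrite ler_pdivrMr// ltr_pdivlMr// (mulrC x) => /andP[h1 h2]; apply/andP; split; lra.
Qed.

Lemma ge0_integral_reflection (h : R -> \bar R) : measurable_fun setT h ->
  (forall x, 0 <= h x)%E ->
  (\int[mu]_(u in `[0%R, t]) h u =
   theta%:E * \int[mu]_(s in `[0%R, (t / theta)%R]) h (t - theta * s)%R)%E.
Proof.
move=> mh h0.
transitivity (\int[nu]_(u in `[0%R, t]) h u)%E.
  by apply: eq_measure_integral => A mA _; exact: nuE.
rewrite ge0_integral_mscale//; last exact: measurable_funTS.
congr (_ * _)%E; rewrite ge0_integral_pushforward//; last exact: measurable_funTS.
have -> : phi @^-1` `[0%R, t] = `[0%R, t / theta]%classic.
  apply/seteqP; split => x; rewrite /phi/= !in_itv/= ler_pdivlMr// (mulrC x).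
    move=> /andP[h1 h2]; apply/andP; split; last by lra.
    by rewrite -(pmulr_rge0 _ theta_gt0); lra.
  move=> /andP[h1 h2]; have := mulr_ge0 (ltW theta_gt0) h1.
  by move=> ?; apply/andP; split; lra.
by [].
Qed.

End reflection.

(** * The variance of the fOU process *)

Section fOU_variance.
Context {R : realType}.
Notation mu := (@lebesgue_measure R).
Notation leb2 := (mu \x mu)%E.
Variables (H theta : R).
Hypotheses (H_gt : 1 / 2 < H) (H_lt : H < 1) (theta_gt0 : 0 < theta).
Local Notation cH := (H * (2 * H - 1)).

Let cH0 : 0 < cH. Proof. exact: hurst_const_gt0. Qed.

Let g (z : R * R) : R := expR (- z.1 - z.2) * `|z.2 - z.1| `^ (2 * H - 2).

Let mg : measurable_fun setT g.
Proof.
apply: measurable_funM.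
  apply: measurableT_comp => //; apply: measurable_funB => //.
  exact: measurableT_comp.
apply: (measurableT_comp (measurable_norm_powR (2 * H - 2))).
by apply: measurable_funB.
Qed.

Let g0 z : 0 <= g z.
Proof. by rewrite mulr_ge0 ?powR_ge0 ?expR_ge0. Qed.

(** [fOU_var] nests real-valued integrals and so passes through [fine] twice. This version stays in
    the extended reals, where Tonelli's theorem and monotonicity apply; finiteness of the inner
    integrals reconciles the two. *)
Definition fOU_double_integral (a : R) : \bar R :=
  (\int[mu]_(s in `[0%R, a]) \int[mu]_(u in `[0%R, a])
    (expR (- s - u) * `|u - s| `^ (2 * H - 2))%:E)%E.

Let dblE a : fOU_double_integral a =
  (\int[leb2]_z (\1_(`[0%R, a]%classic) z.1 * \1_(`[0%R, a]%classic) z.2 * g z)%:E)%E.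
Proof.
exact/esym/(integral_rectangle1 (measurable_itv _) (measurable_itv _) mg g0).
Qed.

Let inner_fin (s a : R) : 0 <= s <= a ->
  (\int[mu]_(u in `[0%R, a]) (expR (- s - u) * `|u - s| `^ (2 * H - 2))%:E)%E \is a fin_num.
Proof.
move=> /andP[s0 sa]; rewrite ge0_fin_numE; last first.
  by apply: integral_ge0 => u _; rewrite lee_fin mulr_ge0 ?powR_ge0 ?expR_ge0.
apply: (@le_lt_trans _ _ (\int[mu]_(u in `[0%R, a]) (`|s - u| `^ (2 * H - 2))%:E)%E); last first.
  have -> : 2 * H - 2 = (2 * H - 1) - 1 by ring.
  rewrite integral_kernel1 ?ltry ?(le_trans s0)//.
  by have := H_gt; lra.
apply: ge0_le_integral => //.
- apply/measurable_EFinP; apply: measurable_funTS.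
  apply: measurable_funM.
    by apply: measurableT_comp => //; apply: measurable_funB.
  apply: (measurableT_comp (measurable_norm_powR (2 * H - 2))).
  by apply: measurable_funB.
- apply/measurable_EFinP; apply: measurable_funTS.
  apply: (measurableT_comp (measurable_norm_powR (2 * H - 2))).
  by apply: measurable_funB.
move=> u; rewrite /= in_itv/= => /andP[u0 _]; rewrite lee_fin distrC ler_piMl ?powR_ge0//.
by rewrite -[leRHS]expR0 ler_expR; lra.
Qed.

Lemma fOU_varE t : fOU_var H theta t =
  cH * theta `^ (2 * H) * fine (fOU_double_integral (t / theta)).
Proof.
rewrite /fOU_var; congr (_ * _); rewrite /Rintegral; congr fine.
by apply: eq_integral => s; rewrite inE/= in_itv/= => sa; rewrite fineK// inner_fin.
Qed.

Let le_double a b : a <= b -> (fOU_double_integral a <= fOU_double_integral b)%E.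
Proof.
move=> ab; rewrite !dblE.
have mI (x : R) : measurable_fun setT (fun z : R * R => \1_(`[0%R, x]%classic) z.1 * \1_(`[0%R, x]%classic) z.2 * g z).
  apply: measurable_funM => //.
  apply: measurable_funM.
    by apply: (@measurableT_comp _ _ _ _ _ _ (\1_(`[0%R, x]%classic) : R -> R)) => //; exact: measurable_indic.
  by apply: (@measurableT_comp _ _ _ _ _ _ (\1_(`[0%R, x]%classic) : R -> R)) => //; exact: measurable_indic.
have sub x : (\1_(`[0%R, a]%classic) x : R) <= \1_(`[0%R, b]%classic) x.
  rewrite !indicE; have [xa|] := boolP (x \in _); last by rewrite ler0n.
  suff -> : x \in `[0%R, b]%classic by [].
  by move: xa; rewrite !inE/= !in_itv/= => /andP[-> /le_trans]; exact.
apply: ge0_le_integral => //.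
- by move=> z _; rewrite lee_fin mulr_ge0// mulr_ge0.
- by apply/measurable_EFinP; exact: mI.
- by apply/measurable_EFinP; exact: mI.
by move=> z _; rewrite lee_fin ler_wpM2r// ler_pM.
Qed.

(** On [[0, a]^2] the factor e^(-s-u) lies between e^(-2a) and 1, and the bare kernel integrates to
    a^(2H) / cH by [integral_kernel2]. *)
Lemma fOU_double_integral_bounds a : 0 <= a ->
  ((expR (- (2 * a)) * (a `^ (2 * H) / cH))%:E <= fOU_double_integral a <=
   (a `^ (2 * H) / cH)%:E)%E.
Proof.
move=> a0.
have b0 : 0 < 2 * H - 1 by have := H_gt; lra.
have hk : ((a `^ (2 * H) / cH)%:E =
   \int[mu]_(u in `[0%R, a]) \int[mu]_(v in `[0%R, a]) (`|u - v| `^ (2 * H - 2))%:E)%E.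
  rewrite [in RHS](_ : 2 * H - 2 = (2 * H - 1) - 1) ?integral_kernel2//; last by ring.
  rewrite subrr normr0 powR0 ?subr0; last by rewrite gt_eqF//; lra.
  congr EFin; rewrite (_ : 2 * H - 1 + 1 = 2 * H); last by ring.
  by have := H_gt => ?; field; rewrite !gt_eqF//; lra.
pose k (z : R * R) : R := `|z.1 - z.2| `^ (2 * H - 2).
have mk : measurable_fun setT k.
  apply: (measurableT_comp (measurable_norm_powR (2 * H - 2))).
  by apply: measurable_funB.
have k0 z : 0 <= k z by exact: powR_ge0.
pose I (z : R * R) : R := \1_(`[0%R, a]%classic) z.1 * \1_(`[0%R, a]%classic) z.2.
have mI : measurable_fun setT I.
  apply: measurable_funM.
    by apply: (@measurableT_comp _ _ _ _ _ _ (\1_(`[0%R, a]%classic) : R -> R)) => //; exact: measurable_indic.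
  by apply: (@measurableT_comp _ _ _ _ _ _ (\1_(`[0%R, a]%classic) : R -> R)) => //; exact: measurable_indic.
have I0 z : 0 <= I z by rewrite mulr_ge0.
have hk2 := integral_rectangle1 (measurable_itv `[0, a]) (measurable_itv `[0, a]) mk k0.
rewrite EFinM hk -hk2 dblE -ge0_integralZl_EFin//; last 2 first.
- by move=> z _; rewrite lee_fin mulr_ge0// I0.
- by apply/measurable_EFinP; exact: (measurable_funM mI mk).
have gk z : I z != 0 -> expR (- (2 * a)) * k z <= g z <= k z.
  rewrite /I /k /g !indicE.
  have [z1|] := boolP (z.1 \in _); last by rewrite mul0r eqxx.
  have [z2|] := boolP (z.2 \in _); last by rewrite mulr0 eqxx.
  move=> _; move: z1 z2; rewrite !inE/= !in_itv/= => /andP[h1 h2] /andP[h3 h4].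
  rewrite (distrC z.2); apply/andP; split.
    by rewrite ler_wpM2r ?powR_ge0// ler_expR; lra.
  by rewrite ler_piMl ?powR_ge0// -[leRHS]expR0 ler_expR; lra.
apply/andP; split; apply: ge0_le_integral => //.
- by move=> z _; rewrite -EFinM lee_fin !mulr_ge0 ?expR_ge0.
- by apply: emeasurable_funM => //; apply/measurable_EFinP; exact: (measurable_funM mI mk).
- by apply/measurable_EFinP; exact: (measurable_funM mI mg).
- move=> z _; rewrite -EFinM lee_fin -/(I z).
  have [->|/gk/andP[h1 h2]] := eqVneq (I z) 0; first by rewrite !mul0r mulr0.
  by rewrite mulrCA ler_wpM2l.
- by move=> z _; rewrite lee_fin !mulr_ge0.
- by apply/measurable_EFinP; exact: (measurable_funM mI mg).
- by apply/measurable_EFinP; exact: (measurable_funM mI mk).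
move=> z _; rewrite lee_fin -/(I z).
have [->|/gk/andP[h1 h2]] := eqVneq (I z) 0; first by rewrite !mul0r.
by rewrite ler_wpM2l.
Qed.

Let dbl_ge0 a : (0 <= fOU_double_integral a)%E.
Proof.
by apply: integral_ge0 => s _; apply: integral_ge0 => u _; rewrite lee_fin mulr_ge0 ?expR_ge0 ?powR_ge0.
Qed.

Let dbl_fin a : fOU_double_integral a \is a fin_num.
Proof.
have [a0|a0] := leP 0 a.
  rewrite ge0_fin_numE//; have /andP[_ h] := fOU_double_integral_bounds a0.
  by rewrite (le_lt_trans h)// ltry.
rewrite /fOU_double_integral set_itv_ge ?integral_set0//.
by rewrite bnd_simp -ltNge.
Qed.

Lemma fOU_var_ge0 t : 0 <= fOU_var H theta t.
Proof. by rewrite fOU_varE mulr_ge0 ?fine_ge0// mulr_ge0 ?powR_ge0// ltW. Qed.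

Lemma nondecreasing_fOU_var : {homo fOU_var H theta : s t / s <= t}.
Proof.
move=> s t st; rewrite !fOU_varE; apply: ler_wpM2l.
  by apply: mulr_ge0; [exact: ltW|exact: powR_ge0].
apply: fine_le; [exact: dbl_fin|exact: dbl_fin|apply: le_double].
by rewrite ler_pM2r// invr_gt0.
Qed.

Lemma measurable_fOU_var : measurable_fun setT (fOU_var H theta).
Proof. exact: nondecreasing_measurable nondecreasing_fOU_var. Qed.

(** The lower bound of [fOU_double_integral_bounds] carries e^(-2t/theta), which decays for large t.
    As V is nondecreasing, t is first replaced by its minimum with theta, where that factor is at
    least e^(-2). The square is ready for the square root in the density. *)
Lemma fOU_var_lower_bound t : 0 < t ->
  (expR (-1) * (Num.min t theta) `^ H) ^+ 2 <= fOU_var H theta t.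
Proof.
move=> t0; have m0 : 0 < Num.min t theta by rewrite lt_min t0.
apply: (@le_trans _ _ (fOU_var H theta (Num.min t theta))); last first.
  by apply: nondecreasing_fOU_var; rewrite ge_min lexx.
have mth : Num.min t theta <= theta by rewrite ge_min lexx orbT.
move: (Num.min t theta) m0 mth => m m0 mth.
rewrite fOU_varE.
have a0 : 0 <= m / theta by rewrite divr_ge0// ltW.
have a1 : m / theta <= 1 by rewrite ler_pdivrMr ?mul1r.
have /andP[h _] := fOU_double_integral_bounds a0.
have {}h : expR (- (2 * (m / theta))) * ((m / theta) `^ (2 * H) / cH) <=
    fine (fOU_double_integral (m / theta)).
  by rewrite -lee_fin fineK.
have c0 : 0 <= cH * theta `^ (2 * H) by rewrite mulr_ge0 ?powR_ge0// ltW.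
apply: le_trans (ler_wpM2l c0 h).
rewrite [leRHS](_ : _ = expR (- (2 * (m / theta))) * m `^ (2 * H)); last first.
  have -> : m `^ (2 * H) = theta `^ (2 * H) * (m / theta) `^ (2 * H).
    by rewrite -powRM ?(ltW theta_gt0)//; congr (_ `^ _); field; rewrite gt_eqF.
  by have := cH0 => ?; field; have := H_gt => ?; rewrite !gt_eqF//; lra.
rewrite exprMn ler_pM ?sqr_ge0//.
  by rewrite -expRM_natl ler_expR; lra.
by rewrite mulrC powRrM powR_mulrn ?powR_ge0.
Qed.

Lemma fOU_var_gt0 t : 0 < t -> 0 < fOU_var H theta t.
Proof.
move=> t0; apply: lt_le_trans (fOU_var_lower_bound t0).
by rewrite exprn_gt0// mulr_gt0 ?expR_gt0// powR_gt0// lt_min t0 theta_gt0.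
Qed.

(** The exponential is at most 1, and the bound on V leaves a multiple of min(t, theta)^(-H). This
    is what ties the Gaussian density to the moment of order -H. *)
Lemma fOU_pdf_ub : exists2 C : R, 0 <= C & forall t x, 0 < t ->
  fOU_pdf H theta t x <= C * (t `^ (- H) + 1).
Proof.
pose K := (Num.sqrt (2 * pi) * expR (-1) : R)^-1.
have K0 : 0 < K.
  by rewrite invr_gt0 mulr_gt0 ?expR_gt0// sqrtr_gt0 mulr_gt0// pi_gt0.
have p1 : 0 < 1 + theta `^ (- H) by rewrite ltr_wpDr ?powR_ge0.
exists (K * (1 + theta `^ (- H))); first by rewrite mulr_ge0 ?ltW.
move=> t x t0; set m := Num.min t theta.
have m0 : 0 < m by rewrite lt_min t0.
have V0 := fOU_var_gt0 t0.
apply: (@le_trans _ _ (Num.sqrt (2 * pi * fOU_var H theta t))^-1).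
  rewrite ler_piMr ?invr_ge0 ?sqrtr_ge0// -[leRHS]expR0 ler_expR oppr_le0.
  by rewrite divr_ge0 ?sqr_ge0// mulr_ge0// ltW.
apply: (@le_trans _ _ (K * m `^ (- H))).
  rewrite /K powRN -invfM lef_pV2 ?posrE; last 2 first.
  - by rewrite sqrtr_gt0 mulr_gt0// mulr_gt0// pi_gt0.
  - by rewrite !mulr_gt0 ?expR_gt0 ?powR_gt0// sqrtr_gt0 mulr_gt0// pi_gt0.
  rewrite (sqrtrM (fOU_var H theta t)) ?mulr_ge0 ?pi_ge0// -mulrA ler_wpM2l ?sqrtr_ge0//.
  have := fOU_var_lower_bound t0; rewrite -/m => h.
  rewrite -[leLHS]ger0_norm ?mulr_ge0 ?expR_ge0 ?powR_ge0// -sqrtr_sqr.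
  by rewrite ler_sqrt// ltW.
(* The minimum is t or theta, and both t^(-H) and theta^(-H) are at most (1 + theta^(-H)) (t^(-H) +
   1). *)
rewrite -mulrA ler_wpM2l ?(ltW K0)//.
have a0 : 0 <= t `^ (- H) by exact: powR_ge0.
have b0 : 0 <= theta `^ (- H) by exact: powR_ge0.
have [|] : m = t \/ m = theta by rewrite /m; case: leP; auto.
  by move=> ->; nra.
by move=> ->; nra.
Qed.

(* Substitute u = t - theta s and v = t - theta r. *)
Lemma fOU_var_limit t : 0 < t ->
  expR (- (t / theta)) ^+ 2 * (cH * fine (\int[mu]_(u in `[0%R, t]) \int[mu]_(v in `[0%R, t])
    (expR (u / theta) * expR (v / theta) * `|u - v| `^ (2 * H - 2))%:E)%E) =
  fOU_var H theta t.
Proof.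
move=> t0.
pose G (z : R * R) : R := expR (z.1 / theta) * expR (z.2 / theta) * `|z.1 - z.2| `^ (2 * H - 2).
have mG : measurable_fun setT G.
  apply: measurable_funM.
    by apply: measurable_funM; apply: measurableT_comp => //; apply: measurable_funM.
  apply: (measurableT_comp (measurable_norm_powR (2 * H - 2))).
  by apply: measurable_funB.
have G0 z : 0 <= G z by rewrite !mulr_ge0 ?expR_ge0 ?powR_ge0.
have mGu u : measurable_fun setT (fun v => (G (u, v))%:E).
  apply/measurable_EFinP; apply: (measurableT_comp mG).
  exact: measurable_pair1.
have e1 : (\int[mu]_(u in `[0%R, t]) \int[mu]_(v in `[0%R, t])
    (expR (u / theta) * expR (v / theta) * `|u - v| `^ (2 * H - 2))%:E =
   theta%:E * \int[mu]_(s in `[0%R, (t / theta)%R]) \int[mu]_(v in `[0%R, t])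
    (G (t - theta * s, v)%R)%:E)%E.
  rewrite -(ge0_integral_reflection t theta_gt0 (h := fun u => \int[mu]_(v in `[0%R, t]) (G (u, v))%:E)%E)//.
  - exact: measurable_integral_section.
  - by move=> u; apply: integral_ge0 => v _; rewrite lee_fin.
have e2 s : (\int[mu]_(v in `[0%R, t]) (G (t - theta * s, v)%R)%:E =
   theta%:E * \int[mu]_(r in `[0%R, (t / theta)%R]) (G (t - theta * s, t - theta * r)%R)%:E)%E.
  apply: (ge0_integral_reflection t theta_gt0 (h := fun v => (G (t - theta * s, v)%R)%:E)).
    exact: mGu.
  by move=> v; rewrite lee_fin.
have e3 s r : (G (t - theta * s, t - theta * r) =
    (expR (t / theta) ^+ 2 * theta `^ (2 * H - 2)) * (expR (- s - r) * `|r - s| `^ (2 * H - 2)))%R.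
  rewrite /G /= (_ : t - theta * s - (t - theta * r) = theta * (r - s)); last by ring.
  rewrite normrM (gtr0_norm theta_gt0) powRM ?normr_ge0 ?(ltW theta_gt0)//.
  have -> : expR ((t - theta * s) / theta) * expR ((t - theta * r) / theta) =
      expR (t / theta) ^+ 2 * expR (- s - r).
    by rewrite -expRD -expRM_natl -expRD; congr expR; field; rewrite gt_eqF.
  by ring.
(* What the substitution pulls out of the integrand. The exponential will cancel the prefactor, and
   with the two Jacobians theta^2 the power becomes the theta^(2H) of [fOU_var]. *)
pose c := expR (t / theta) ^+ 2 * theta `^ (2 * H - 2).
have c0 : 0 <= c by rewrite mulr_ge0 ?sqr_ge0 ?powR_ge0.
have e4 : (\int[mu]_(u in `[0%R, t]) \int[mu]_(v in `[0%R, t])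
    (expR (u / theta) * expR (v / theta) * `|u - v| `^ (2 * H - 2))%:E =
    (theta * (theta * c))%:E * fOU_double_integral (t / theta))%E.
  rewrite e1 (EFinM theta (theta * c)) (EFinM theta c) -(muleA theta%:E) -(muleA theta%:E).
  congr (_ * _)%E.
  have mD : measurable (`[0%R, (t / theta)%R] : set R) by exact: measurable_itv.
  pose F s := (\int[mu]_(r in `[0%R, (t / theta)%R]) (G (t - theta * s, t - theta * r)%R)%:E)%E.
  have mF : measurable_fun `[0%R, (t / theta)%R] F.
    apply: measurable_funTS.
    apply: (@measurable_integral_section R _ (fun z => G (t - theta * z.1, t - theta * z.2)) mD).
      apply: (measurableT_comp mG).
      by apply: measurable_fun_pair; apply: measurable_funB => //; apply: measurable_funM.
    by move=> z; exact: G0.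
  have F0 s : `[0%R, (t / theta)%R]%classic s -> (0 <= F s)%E.
    by move=> _; apply: integral_ge0 => r _; rewrite lee_fin.
  have mI : measurable_fun `[0%R, (t / theta)%R] (fun s => \int[mu]_(r in `[0%R, (t / theta)%R]) (g (s, r))%:E)%E.
    by apply: measurable_funTS; exact: (@measurable_integral_section R _ g mD mg g0).
  have I0 s : `[0%R, (t / theta)%R]%classic s -> (0 <= \int[mu]_(r in `[0%R, (t / theta)%R]) (g (s, r))%:E)%E.
    by move=> _; apply: integral_ge0 => r _; rewrite lee_fin.
  transitivity (\int[mu]_(s in `[0%R, (t / theta)%R]) (theta%:E * F s))%E.
    by apply: eq_integral => s _; exact: e2.
  apply: etrans; first exact: (ge0_integralZl_EFin mu mD F0 mF (ltW theta_gt0)).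
  congr (_ * _)%E.
  apply: etrans; last exact: (ge0_integralZl_EFin mu mD I0 mI c0).
  apply: eq_integral => s _.
  have mgs : measurable_fun `[0%R, (t / theta)%R] (fun r => (g (s, r))%:E).
    apply/measurable_EFinP; apply: measurable_funTS; apply: (measurableT_comp mg).
    exact: measurable_pair1.
  have gs0 r : `[0%R, (t / theta)%R]%classic r -> (0 <= (g (s, r))%:E)%E by rewrite lee_fin.
  apply: etrans; last exact: (ge0_integralZl_EFin mu mD gs0 mgs c0).
  by apply: eq_integral => r _; rewrite e3 (EFinM c).
rewrite e4 fineM ?dbl_fin// fOU_varE /=.
rewrite (_ : theta `^ (2 * H) = theta * (theta * theta `^ (2 * H - 2))).
  by rewrite /c expRN; field; rewrite gt_eqF ?expR_gt0.
rewrite powRB; last by apply/implyP => _; rewrite gt_eqF.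
by rewrite (powR_mulrn 2 (ltW theta_gt0)); field; rewrite gt_eqF.
Qed.

End fOU_variance.

(** * The law of the fOU process at a fixed time *)

Section fOU_law.
Context d (T : measurableType d) (R : realType) (P : probability T R).
Notation mu := (@lebesgue_measure R).
Variables (H theta : R).
Hypotheses (H_gt : 1 / 2 < H) (H_lt : H < 1) (theta_gt0 : 0 < theta).
Variables (B U : R -> T -> R).
Hypotheses (fB : is_fBm P H B) (fU : is_fOU P H theta B U).

Lemma fOU_measurable y : 0 <= y -> measurable_fun setT (U y).
Proof.
move=> /(fOU_wiener fU)[I [mI _] UI].
have -> : U y = (fun w => expR (- (y / theta)) * I w) by apply/funext.
exact: measurable_funM.
Qed.

(** The factor e^(-y/theta) of U is absorbed into the coefficients, so that elementary integrals
    approximate U(y) itself and [gauss_L2_limit] applies to them directly. *)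
Let scale_steps (c : R) (s : seq (R * R)) := [seq (c * a.1, a.2) | a <- s].

Let step_int_scale c s w : step_int B (scale_steps c s) w = c * step_int B s w.
Proof.
by rewrite /step_int big_map mulr_sumr; apply: eq_bigr => a _; rewrite /= mulrA.
Qed.

Let step_variance_scale c s : step_variance H (scale_steps c s) = c ^+ 2 * step_variance H s.
Proof.
rewrite /step_variance big_map mulr_sumr; apply: eq_bigr => a _.
by rewrite big_map mulr_sumr; apply: eq_bigr => b _ /=; ring.
Qed.

Lemma fOU_expectation (phi : R -> R) (L : R) y : 0 < y ->
  (forall x, 0 <= phi x <= 1) -> (forall x z, `|phi x - phi z| <= L * `|x - z|) ->
  (\int[P]_w (phi (U y w))%:E = \int[mu]_x (phi x * fOU_pdf H theta y x)%:E)%E.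
Proof.
move=> y0 phi01 phiL.
have [I [mI [s [st cvgs cvgI]]] UI] := fOU_wiener fU (ltW y0).
pose c := expR (- (y / theta)).
have st0 n : all (fun a => 0 <= a.2) (s n).
  by apply: sub_all (st n) => a /andP[].
have sc0 n : all (fun a => 0 <= a.2) (scale_steps c (s n)) by rewrite all_map; exact: st0.
have mS n : measurable_fun setT (step_int B (s n)) by case: (fBm_gaussian fB (st0 n)).
apply: (gauss_L2_limit phi01 phiL (J := fun n => step_int B (scale_steps c (s n)))
  (v_ := fun n => c ^+ 2 * step_variance H (s n))).
- by move=> n; apply: (fBm_gaussian fB).
- by move=> n; exact: (step_int_expectation fB).
- by move=> n; rewrite (step_int_variance fB)// step_variance_scale.
(* [fOU_var_limit] presents V(y) through the form at the integrand e^(u/theta), which is bounded on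
   [[0, y]] by e^(y/theta). *)
- rewrite -(fOU_var_limit H_gt theta_gt0 y0).
  apply: cvgM; first exact: cvg_cst.
  apply: (step_variance_cvg H_gt H_lt (ltW y0) (f := fun u => expR (u / theta))
    (M0 := expR (y / theta))) => //.
  + by apply: measurableT_comp => //; exact: measurable_funM.
  + move=> u; rewrite /= in_itv/= => /andP[_ uy].
    by rewrite ler_expR ler_pM2r// invr_gt0.
- exact: fOU_var_gt0.
- exact: fOU_measurable (ltW y0).
have -> : (fun n => 'E_P[fun w => ((step_int B (scale_steps c (s n)) w - U y w) ^+ 2)%R]%E) =
    (fun n => (c ^+ 2)%:E * 'E_P[fun w => ((step_int B (s n) w - I w) ^+ 2)%R])%E.
  apply/funext => n; rewrite unlock -ge0_integralZl_EFin ?sqr_ge0//.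
  - apply: eq_integral => w _; rewrite -EFinM; congr EFin.
    by rewrite step_int_scale UI -/c; ring.
  - by move=> w _; rewrite lee_fin sqr_ge0.
  - by apply/measurable_EFinP; apply: measurable_funX; exact: measurable_funB.
rewrite -[X in _ --> X](mule0 (c ^+ 2)%:E).
by apply: cvgeZl.
Qed.

End fOU_law.

(** * Evaluation at an independent random time *)

Section random_time.
Context d (T : measurableType d) (R : realType) (P : probability T R).
Variables (E : T -> R) (U : R -> T -> R).
Hypotheses (P_complete : measure_is_complete P)
  (mE : measurable_fun setT E) (E_ge0 : forall w, 0 <= E w)
  (mU : forall y, 0 <= y -> measurable_fun setT (U y))
  (U_cont : {ae P, forall w, {within `[0, +oo[, continuous (fun y => U y w)}})
  (E_indep : forall y (A C : set R), 0 <= y -> measurable A -> measurable C ->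
    P (E @^-1` A `&` U y @^-1` C) = (P (E @^-1` A) * P (U y @^-1` C))%E).
Variables (phi : R -> R) (L : R).
Hypotheses (phi01 : forall x, 0 <= phi x <= 1)
  (phiL : forall x y, `|phi x - phi y| <= L * `|x - y|).

Let mphi : measurable_fun setT phi.
Proof. exact: continuous_measurable_fun (lipschitz_continuous_fun phiL). Qed.

Let phi0 x : 0 <= phi x. Proof. by case/andP: (phi01 x). Qed.

Let G (y : R) : R := fine (\int[P]_w (phi (U y w))%:E)%E.

Let mphiU y : 0 <= y -> measurable_fun setT (fun w => (phi (U y w))%:E).
Proof. by move=> /mU mUy; apply/measurable_EFinP; exact: measurableT_comp. Qed.

Let GE y : 0 <= y -> (G y)%:E = (\int[P]_w (phi (U y w))%:E)%E.
Proof.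
move=> /mU mUy; rewrite /G fineK//.
by apply: integrable_fin_num => //; exact: (integrable_lipschitz01 P phi01 phiL mUy).
Qed.

Let G_ge0 y : 0 <= G y.
Proof. by rewrite fine_ge0//; apply: integral_ge0 => w _; rewrite lee_fin. Qed.

Let G_le1 y : 0 <= y -> G y <= 1.
Proof.
move=> y0; rewrite -lee_fin GE// -(expectation_cst P 1) unlock.
apply: ge0_le_integral => //.
- by move=> w _; rewrite lee_fin.
- exact: mphiU.
- exact: (measurable_cst (1 : R)%:E).
by move=> w _; rewrite lee_fin; case/andP: (phi01 (U y w)).
Qed.

(** By independence, the law of [U y] under P restricted to the event that E lies in A is P(E in A)
    times its law under P; phi is integrated against both. *)
Let split_event y (A : set R) : 0 <= y -> measurable A ->
  (\int[P]_(w in E @^-1` A) (phi (U y w))%:E = P (E @^-1` A) * (G y)%:E)%E.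
Proof.
move=> y0 mA.
have mEA : measurable (E @^-1` A) by rewrite -[X in measurable X]setTI; exact: mE.
have m1 : measurable_fun setT (\1_(E @^-1` A) : T -> R) by exact: measurable_indic.
pose PA : {measure set T -> \bar R} := mrestr P mEA.
have mUy : measurable_fun setT (U y : T -> measurableTypeR R) by exact: mU.
pose pf (m : {measure set T -> \bar R}) := image_measure m mUy.
have mphiE : measurable_fun setT (fun x : measurableTypeR R => (phi x)%:E).
  exact/measurable_EFinP.
have fPA : P (E @^-1` A) \is a fin_num by exact: fin_num_measure.
have fPA0 : 0 <= fine (P (E @^-1` A)) by rewrite fine_ge0.
transitivity (\int[PA]_w (phi (U y w))%:E)%E.
  have PAE C : measurable C -> PA C = (\int[P]_(w in C) (\1_(E @^-1` A) w)%:E)%E.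
    by move=> mC; rewrite /PA/= /mrestr integral_indic// setIC.
  have i0 w : 0 <= (\1_(E @^-1` A) w : R) by [].
  have h0 w : (0 <= (phi (U y w))%:E)%E by rewrite lee_fin.
  rewrite (ge0_integral_density m1 i0 PAE (mphiU y0) h0).
  rewrite [LHS]integral_mkcond; apply: eq_integral => w _.
  by rewrite patchE indicE; case: ifPn => _; rewrite ?mule1 ?mule0.
transitivity (\int[pf PA]_x (phi x)%:E)%E.
  by rewrite ge0_integral_pushforward// => x _; rewrite lee_fin.
transitivity (\int[mscale (NngNum fPA0) (pf P)]_x (phi x)%:E)%E.
  apply: eq_measure_integral => C mC _.
  rewrite /mscale /=  /pushforward /PA /mrestr /=.
  rewrite setIC; apply: etrans; first exact: E_indep.
  by rewrite -[X in (X * _)%E = _](fineK fPA).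
rewrite ge0_integral_mscale//=; last by move=> x _; rewrite lee_fin.
rewrite ge0_integral_pushforward//; last by move=> x _; rewrite lee_fin.
by rewrite -[in RHS](fineK fPA) GE.
Qed.

(* The largest multiple of 1 / (n + 1) below e >= 0. *)
Let disc (n : nat) (e : R) : R := (Num.truncn (n.+1%:R * e))%:R / n.+1%:R.

Let disc_ge0 n e : 0 <= disc n e.
Proof. by rewrite divr_ge0. Qed.

Let disc_cvg e : 0 <= e -> disc n e @[n --> \oo] --> e.
Proof.
move=> e0; apply: (@squeeze_cvgr _ _ _ _ (fun n => e - n.+1%:R^-1) (cst e)).
- near=> n; have n0 : 0 < n.+1%:R :> R by rewrite ltr0n.
  have /andP[h1 h2] := truncn_itv (mulr_ge0 (ltW n0) e0).
  rewrite /disc ler_pdivrMr// ler_pdivlMr// mulrBl mulVf ?gt_eqF// (mulrC e) h1 andbT.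
  by rewrite lerBlDr natr1 ltW.
- rewrite -[X in _ --> X](subr0 e); apply: cvgB; first exact: cvg_cst.
  exact: cvg_harmonic.
- exact: cvg_cst.
Unshelve. all: by end_near. Qed.

(** Half-open, so that on the nonnegative half-line the cells are exactly the level sets of the
    truncation in [disc n]. *)
Let cell (n k : nat) : set R := `[k%:R / n.+1%:R, k.+1%:R / n.+1%:R[%classic.

Let cellP n k e : 0 <= e -> cell n k e <-> Num.truncn (n.+1%:R * e) = k.
Proof.
move=> e0; have n0 : 0 < n.+1%:R :> R by rewrite ltr0n.
rewrite /cell /= in_itv/= ler_pdivrMr// ltr_pdivlMr// (mulrC e).
rewrite -(truncn_eq _ (mulr_ge0 (ltW n0) e0)).
by split => /eqP.
Qed.

Let cell_cover n : \bigcup_k (E @^-1` cell n k) = setT.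
Proof.
apply/seteqP; split => // w _; exists (Num.truncn (n.+1%:R * E w)) => //.
exact/cellP.
Qed.

Let cell_triv n : trivIset setT (fun k => E @^-1` cell n k).
Proof.
apply/trivIsetP => i j _ _ ij; rewrite -subset0 => w [/= hi hj].
move/cellP : hi => /(_ (E_ge0 w)) hi; move/cellP : hj => /(_ (E_ge0 w)) hj.
by move: ij; rewrite -hi hj eqxx.
Qed.

Let mcell n k : measurable (cell n k). Proof. exact: measurable_itv. Qed.

Let mEcell n k : measurable (E @^-1` cell n k).
Proof. by rewrite -[X in measurable X]setTI; exact: mE. Qed.

Let disc_cell n k w : (E @^-1` cell n k) w -> disc n (E w) = k%:R / n.+1%:R.
Proof. by move=> /(cellP _ _ (E_ge0 w)) h; rewrite /disc h. Qed.

(** On each of the countably many events where E lies in a given cell, the time is the constant k /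
    (n + 1), and measurability at fixed times is enough. *)
Let measurable_disc (F : R -> T -> R) n :
  (forall y, 0 <= y -> measurable_fun setT (F y)) ->
  measurable_fun setT (fun w => F (disc n (E w)) w).
Proof.
move=> mF; rewrite -(cell_cover n); apply/measurable_fun_bigcup => // k.
apply: (eq_measurable_fun (F (k%:R / n.+1%:R))).
  by move=> w; rewrite inE => /disc_cell ->.
by apply: measurable_funTS; apply: mF; rewrite divr_ge0.
Qed.

Let disc_expectation n :
  (\int[P]_w (phi (U (disc n (E w)) w))%:E = \int[P]_w (G (disc n (E w)))%:E)%E.
Proof.
have m1 : measurable_fun setT (fun w => (phi (U (disc n (E w)) w))%:E).
  apply/measurable_EFinP; apply: (measurable_disc (F := fun y w => phi (U y w))) => y y0.
  by apply: measurableT_comp => //; exact: mU.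
have m2 : measurable_fun setT (fun w => (G (disc n (E w)))%:E).
  apply/measurable_EFinP; apply: (measurable_disc (F := fun y w => G y)) => y y0.
  exact: measurable_cst.
rewrite -(cell_cover n) !ge0_integral_bigcup ?cell_cover//; last 2 first.
- by move=> w _; rewrite lee_fin.
- by move=> w _; rewrite lee_fin.
apply: eq_eseriesr => k _.
have k0 : 0 <= k%:R / n.+1%:R :> R by rewrite divr_ge0.
transitivity (\int[P]_(w in E @^-1` cell n k) (phi (U (k%:R / n.+1%:R)%R w))%:E)%E.
  by apply: eq_integral => w; rewrite inE => /disc_cell ->.
rewrite split_event//.
transitivity (\int[P]_(w in E @^-1` cell n k) (G (k%:R / n.+1%:R)%R)%:E)%E; last first.
  by apply: eq_integral => w; rewrite inE => /disc_cell ->.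
by rewrite (integral_cst P (mEcell n k)) muleC.
Qed.

(** The quantifier over e stands inside: continuity of the path gives a single null set for all
    times, which allows e to be the random time [E w]. *)
Let U_disc_cvg : {ae P, forall w, forall e, 0 <= e -> U (disc n e) w @[n --> \oo] --> U e w}.
Proof.
apply: filterS U_cont => w /subspace_continuousP cw e e0.
have De : `[0%R, +oo[%classic e by rewrite /= in_itv/= e0.
have /= h := cw e De.
apply: (@cvg_comp _ _ _ (disc^~ e) (fun y => U y w) _ _ _ _ h).
move=> A [eps /= eps0 hA]; have /cvgrPdist_lt /(_ _ eps0) [N _ hN] := disc_cvg e0.
by exists N => // n Nn; apply: hA; [exact: hN|rewrite /= in_itv/= disc_ge0].
Qed.

Let cphi : continuous phi. Proof. exact: lipschitz_continuous_fun phiL. Qed.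

(** Holds at every e >= 0, in contrast with the paths: the exceptional null set disappears in the
    expectation. *)
Let G_disc_cvg e : 0 <= e -> G (disc n e) @[n --> \oo] --> G e.
Proof.
move=> e0.
have h : (\int[P]_w (phi (U (disc n e) w))%:E)%E @[n --> \oo] --> (\int[P]_w (phi (U e w))%:E)%E.
  have := @dominated_convergence _ _ R P setT measurableT
    (fun n w => (phi (U (disc n e) w))%:E) (fun w => (phi (U e w))%:E) (cst 1%E).
  case=> //.
  - by move=> n; exact: mphiU.
  - exact: mphiU.
  - apply: filterS U_disc_cvg => w hw _; apply: cvg_EFin; first exact: nearW.
    by apply: continuous_cvg; [exact: cphi|exact: hw].
  - exact: finite_measure_integrable_cst.
  - by apply: aeW => w n _; rewrite lee_fin ger0_norm//; case/andP: (phi01 (U (disc n e) w)).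
move: h; rewrite -GE// => /fine_cvgP[_]; apply: cvg_trans.
by apply: near_eq_cvg; near=> n.
Unshelve. all: by end_near. Qed.

(* Only almost everywhere a limit of measurable functions: completeness of P is
   needed. *)
Lemma measurable_random_time : measurable_fun setT (fun w => U (E w) w).
Proof.
(* Multiplication by the indicator of the complement of N gives convergence at every w; only on N
   can the limit differ from [U (E w) w]. *)
have [N [mN N0 hN]] := U_disc_cvg.
have mNC : measurable (~` N) by exact: measurableC.
apply/measurable_EFinP.
apply: (@ae_measurable_fun _ _ _ P P_complete setT (EFin \o (fun w => U (E w) w * \1_(~` N) w))).
  exists N; split => // w /= h; apply: contrapT => Nw; apply: h => _.
  by rewrite indicE mem_set// mulr1.
apply/measurable_EFinP.
apply: (@measurable_fun_cvg _ _ _ setT (fun n w => U (disc n (E w)) w * \1_(~` N) w)).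
  move=> n; apply: measurable_funM; last exact: measurable_indic.
  exact: measurable_disc.
move=> w _; rewrite indicE; have [Nw|Nw] := boolP (w \in ~` N).
  apply: cvgM; last exact: cvg_cst.
  have : (~` N) w by rewrite inE in Nw.
  by move=> Nw'; apply: contrapT => h; apply: Nw'; apply: hN => /= h2; exact: (h (h2 _ (E_ge0 w))).
by under eq_fun do rewrite mulr0; rewrite mulr0; exact: cvg_cst.
Qed.

Let mG : measurable_fun setT (fun w => G (E w)).
Proof.
apply: (@measurable_fun_cvg _ _ _ setT (fun n w => G (disc n (E w)))).
  by move=> n; apply: (measurable_disc (F := fun y w => G y)) => y y0; exact: measurable_cst.
by move=> w _; exact: G_disc_cvg.
Qed.

Lemma measurable_random_time_mean :
  measurable_fun setT (fun w => \int[P]_v (phi (U (E w) v))%:E)%E.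
Proof.
have -> : (fun w => \int[P]_v (phi (U (E w) v))%:E)%E = EFin \o (fun w => G (E w)).
  by apply/funext => w /=; rewrite GE.
exact/measurable_EFinP.
Qed.

Lemma random_time_expectation :
  (\int[P]_w (phi (U (E w) w))%:E = \int[P]_w \int[P]_v (phi (U (E w) v))%:E)%E.
Proof.
transitivity (\int[P]_w (G (E w))%:E)%E; last first.
  by apply: eq_integral => w _; rewrite GE.
have h1 : (\int[P]_w (phi (U (disc n (E w)) w))%:E)%E @[n --> \oo] --> (\int[P]_w (phi (U (E w) w))%:E)%E.
  have := @dominated_convergence _ _ R P setT measurableT
    (fun n w => (phi (U (disc n (E w)) w))%:E) (fun w => (phi (U (E w) w))%:E) (cst 1%E).
  case=> //.
  - move=> n; apply/measurable_EFinP; apply: (measurable_disc (F := fun y w => phi (U y w))) => y y0.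
    by apply: measurableT_comp => //; exact: mU.
  - apply/measurable_EFinP; apply: measurableT_comp => //; exact: measurable_random_time.
  - apply: filterS U_disc_cvg => w hw _; apply: cvg_EFin; first exact: nearW.
    by apply: continuous_cvg; [exact: cphi|exact: hw].
  - exact: finite_measure_integrable_cst.
  - by apply: aeW => w n _; rewrite lee_fin ger0_norm//; case/andP: (phi01 (U (disc n (E w)) w)).
have h2 : (\int[P]_w (G (disc n (E w)))%:E)%E @[n --> \oo] --> (\int[P]_w (G (E w))%:E)%E.
  have := @dominated_convergence _ _ R P setT measurableT
    (fun n w => (G (disc n (E w)))%:E) (fun w => (G (E w))%:E) (cst 1%E).
  case=> //.
  - move=> n; apply/measurable_EFinP; apply: (measurable_disc (F := fun y w => G y)) => y y0.
    exact: measurable_cst.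
  - exact/measurable_EFinP.
  - by apply: aeW => w _; apply: cvg_EFin; [exact: nearW|exact: G_disc_cvg].
  - exact: finite_measure_integrable_cst.
  - by apply: aeW => w n _; rewrite lee_fin ger0_norm// G_le1.
suff h3 : (\int[P]_w (phi (U (disc n (E w)) w))%:E)%E @[n --> \oo] --> (\int[P]_w (G (E w))%:E)%E.
  exact: (cvg_unique _ h1 h3).
by under eq_fun do rewrite disc_expectation.
Qed.

End random_time.

(** * Mixtures and laws with a density *)

Section density_measure.
Context {R : realType}.
Notation mu := (@lebesgue_measure R).
Variables (p : R -> R) (mp : measurable_fun setT p) (p0 : forall x, 0 <= p x).

(* The proofs are arguments because the measure instance depends on them. *)
Definition density_measure (_ : measurable_fun setT p) (_ : forall x, 0 <= p x)
  (A : set (measurableTypeR R)) : \bar R := (\int[mu]_(x in A) (p x)%:E)%E.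

Let nu := density_measure mp p0.

Let nu0 : nu set0 = 0%E. Proof. exact: integral_set0. Qed.

Let nu_ge0 A : (0 <= nu A)%E.
Proof. by apply: integral_ge0 => x _; rewrite lee_fin. Qed.

Let nu_sigma_additive : semi_sigma_additive nu.
Proof.
move=> F mF tF mUF; rewrite /nu /density_measure; apply: cvg_toP.
  apply: ereal_nondecreasing_is_cvgn => m n mn.
  apply: lee_sum_nneg_natr => // k _ _.
  by apply: integral_ge0 => x _; rewrite lee_fin.
rewrite ge0_integral_bigcup//=.
- by apply/measurable_EFinP; exact: measurable_funTS.
- by move=> x _; rewrite lee_fin.
Qed.

HB.instance Definition _ := isMeasure.Build _ _ _
  (density_measure mp p0) nu0 nu_ge0 nu_sigma_additive.

End density_measure.

Section ramp.
Context {R : realType}.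
Implicit Types (a x : R) (k : nat).

(** Zero up to a, then of slope k, capped at 1. It vanishes at a itself and so tends to the
    indicator of the open ray. *)
Definition ramp k a x : R := Num.min 1 (k%:R * Num.max 0 (x - a)).

Lemma ramp01 k a x : 0 <= ramp k a x <= 1.
Proof. by rewrite /ramp le_min ler01 mulr_ge0 ?le_max ?lexx//= ge_min lexx. Qed.

Lemma ramp_lipschitz k a x y : `|ramp k a x - ramp k a y| <= k%:R * `|x - y|.
Proof.
have min_lip (u v : R) : `|Num.min 1 u - Num.min 1 v| <= `|u - v|.
  rewrite /Num.min; case: ifPn => h1; case: ifPn => h2; rewrite -?leNgt in h1 h2;
    by rewrite ler_norml; have := ler_norm (u - v); have := ler_norm (v - u); rewrite distrC; lra.
have max_lip (u v : R) : `|Num.max 0 u - Num.max 0 v| <= `|u - v|.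
  rewrite /Num.max; case: ifPn => h1; case: ifPn => h2; rewrite -?leNgt in h1 h2;
    by rewrite ler_norml; have := ler_norm (u - v); have := ler_norm (v - u); rewrite distrC; lra.
apply: le_trans (min_lip _ _) _; rewrite -mulrBr normrM ger0_norm// ler_wpM2l//.
apply: le_trans (max_lip _ _) _.
by rewrite (_ : x - a - (y - a) = x - y)//; ring.
Qed.

Lemma ramp_cvg a x : ramp k a x @[k --> \oo] --> (\1_(`]a, +oo[%classic) x : R).
Proof.
rewrite indicE; have [xa|xa] := boolP (x \in _).
  move: xa; rewrite inE/= in_itv/= andbT => ax.
  have xa0 : 0 < x - a by rewrite subr_gt0.
  have [N _ hN] : \forall k \near \oo, (x - a)^-1 <= k%:R by exact: nbhs_infty_ger.
  apply: cvg_near_cst; exists N => // n /hN /= h.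
  rewrite /ramp; apply/min_idPl.
  rewrite (max_idPr (ltW xa0)) -ler_pdivrMr ?mul1r//.
have -> : (fun k => ramp k a x) = cst 0; last exact: cvg_cst.
apply/funext => k; rewrite /ramp (max_idPl _) ?mulr0; first exact/min_idPr.
by rewrite subr_le0 leNgt; apply: contra xa => ax; rewrite inE/= in_itv/= ax.
Qed.

End ramp.

Section density_criterion.
Context d (T : measurableType d) (R : realType) (P : probability T R).
Notation mu := (@lebesgue_measure R).
Variables (X : T -> R) (p : R -> R).
Hypotheses (mX : measurable_fun setT X) (mp : measurable_fun setT p)
  (p0 : forall x, 0 <= p x).
Hypothesis Xp : forall (phi : R -> R) (L : R), (forall x, 0 <= phi x <= 1) ->
  (forall x y, `|phi x - phi y| <= L * `|x - y|) ->
  (\int[P]_w (phi (X w))%:E = \int[mu]_x (phi x * p x)%:E)%E.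

Let mX' : measurable_fun setT (X : T -> measurableTypeR R). Proof. exact: mX. Qed.
Let law := image_measure P mX'.
Let nu : {measure set (measurableTypeR R) -> \bar R} := density_measure mp p0.

(** The constant 1 is an admissible test function, with Lipschitz constant 0: it shows that p has
    integral 1. Integrability makes p the majorant for the ramps. *)
Let integrable_p : mu.-integrable setT (EFin \o p).
Proof.
apply/integrableP; split; first exact/measurable_EFinP.
pose one (x : R) : R := 1.
have cst01 x : 0 <= one x <= 1 by rewrite /one ler01 lexx.
have cst_lip x y : `|one x - one y| <= 0 * `|x - y|.
  by rewrite subrr normr0 mul0r.
have := Xp cst01 cst_lip.
have -> : (\int[P]_w (one (X w))%:E)%E = 1%E.
  by rewrite -[RHS](expectation_cst P 1) unlock.
move=> h; apply: (@le_lt_trans _ _ 1%E); last exact: ltry.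
rewrite h le_eqVlt; apply/orP; left; apply/eqP; apply: eq_integral => x _ /=.
by rewrite mul1r ger0_norm.
Qed.

Let law_ray a : law `]a, +oo[%classic = nu `]a, +oo[%classic.
Proof.
have mray : measurable (`]a, +oo[ : set R) by exact: measurable_itv.
have mramp k : measurable_fun setT (@ramp R k a).
  exact: continuous_measurable_fun (lipschitz_continuous_fun (ramp_lipschitz k a)).
have ramp0 k x : 0 <= ramp k a x by case/andP: (ramp01 k a x).
have ramp1 k x : ramp k a x <= 1 by case/andP: (ramp01 k a x).
have m1 : measurable_fun setT (\1_(`]a, +oo[%classic) : R -> R) by exact: measurable_indic.
have h1 : (\int[P]_w (ramp k a (X w))%:E)%E @[k --> \oo] --> law `]a, +oo[%classic.
  have -> : law `]a, +oo[%classic = (\int[P]_w (\1_(`]a, +oo[%classic) (X w))%:E)%E.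
    rewrite -[RHS]/(\int[P]_w (\1_(X @^-1` `]a, +oo[) w)%:E)%E integral_indic ?setIT//.
    by rewrite -[X in measurable X]setTI; exact: mX.
  have := @dominated_convergence _ _ R P setT measurableT
    (fun k w => (ramp k a (X w))%:E) (fun w => (\1_(`]a, +oo[%classic) (X w))%:E) (cst 1%E).
  case=> //.
  - by move=> k; apply/measurable_EFinP; exact: measurableT_comp.
  - apply/measurable_EFinP; exact: (measurableT_comp m1 mX).
  - by apply: aeW => w _; apply: cvg_EFin; [exact: nearW|exact: ramp_cvg].
  - exact: finite_measure_integrable_cst.
  - by apply: aeW => w k _; rewrite lee_fin ger0_norm.
have h2 : (\int[mu]_x (ramp k a x * p x)%:E)%E @[k --> \oo] --> nu `]a, +oo[%classic.
  have -> : nu `]a, +oo[%classic = (\int[mu]_x (\1_(`]a, +oo[%classic) x * p x)%:E)%E.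
    rewrite -[LHS]/(\int[mu]_(x in `]a, +oo[) (p x)%:E)%E [LHS]integral_mkcond; apply: eq_integral => x _.
    by rewrite patchE indicE; case: ifPn => _; rewrite ?mul1r ?mul0r.
  have := @dominated_convergence _ _ R mu setT measurableT
    (fun k x => (ramp k a x * p x)%:E) (fun x => (\1_(`]a, +oo[%classic) x * p x)%:E) (EFin \o p).
  case=> //.
  - by move=> k; apply/measurable_EFinP; exact: (measurable_funM (mramp k) mp).
  - by apply/measurable_EFinP; exact: (measurable_funM m1 mp).
  - apply: aeW => x _; apply: cvg_EFin; first exact: nearW.
    by apply: cvgM; [exact: ramp_cvg|exact: cvg_cst].
  - by apply: aeW => x k _; rewrite lee_fin ger0_norm ?mulr_ge0// ler_piMl.
suff h3 : (\int[P]_w (ramp k a (X w))%:E)%E @[k --> \oo] --> nu `]a, +oo[%classic.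
  exact: (cvg_unique _ h1 h3).
have -> : (fun k => \int[P]_w (ramp k a (X w))%:E)%E = (fun k => \int[mu]_x (ramp k a x * p x)%:E)%E.
  by apply/funext => k; apply: Xp; [exact: ramp01|exact: ramp_lipschitz].
exact: h2.
Qed.

Lemma has_density_of_lipschitz : has_density P X p.
Proof.
split => // A mA; rewrite -[LHS]/(law A) -[RHS]/(nu A).
(* Rays of finite mass that exhaust the line. Open rays generate the Borel sets and are stable under
   intersection, so that agreement on them suffices. *)
pose g (n : nat) : set R := `]- n%:R, +oo[%classic.
apply: (@measure_unique _ R (measurableTypeR R) (@RGenOInfty.G R) g _ _ _ _ law nu) => //.
- exact: RGenOInfty.measurableE.
- move=> _ _ [x ->] [y ->]; exists (Num.max x y).
  by apply/seteqP; split => z /=; rewrite !in_itv/= !andbT gt_max; [move=> [-> ->]|move=> /andP].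
- by move=> n; exists (- n%:R).
- apply/seteqP; split => // x _.
  have [N _ hN] : \forall k \near \oo, `|x| + 1 <= k%:R by exact: nbhs_infty_ger.
  exists N => //=; rewrite /g /= in_itv/= andbT; have := hN N (leqnn N); rewrite /=.
  by have := ler_norm (- x); rewrite normrN; lra.
- by move=> _ [x ->]; exact: law_ray.
- move=> n; rewrite -[ltLHS]/(P (X @^-1` g n)) -ge0_fin_numE//.
  by apply: fin_num_measure; rewrite -[X in measurable X]setTI; apply: mX => //; exact: measurable_itv.
Qed.

End density_criterion.

(** True for every w, an empty set of times included, because its [inf] is 0. *)
Lemma inverse_subordinator_ge0 (R : realType) d (T : measurableType d)
  (sigma : R -> T -> R) t w : 0 <= inverse_subordinator sigma t w.
Proof.
rewrite /inverse_subordinator; have [->|/set0P A0] := eqVneq [set y | 0 < y /\ t < sigma y w] set0.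
  by rewrite inf0.
by apply: lb_le_inf => // y [/ltW].
Qed.

Section fOU_mixture.
Context {R : realType}.
Notation mu := (@lebesgue_measure R).
Variables (H theta : R).
Hypotheses (H_gt : 1 / 2 < H) (theta_gt0 : 0 < theta).
Implicit Types (f phi : R -> R).

Lemma fOU_pdf_ge0 y x : 0 <= fOU_pdf H theta y x.
Proof. by rewrite mulr_ge0 ?invr_ge0 ?sqrtr_ge0 ?expR_ge0. Qed.

Lemma measurable_fOU_pdf :
  measurable_fun setT (fun z : R * R => fOU_pdf H theta z.1 z.2).
Proof.
have mV : measurable_fun setT (fun z : R * R => fOU_var H theta z.1).
  by apply: (measurableT_comp (measurable_fOU_var H_gt theta_gt0)).
have V0 z : 0 <= fOU_var H theta z by exact: fOU_var_ge0.
(* Inverses become powers of exponent -1, for which [measurable_powR] applies; the two agree on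
   nonnegative bases, 0 included. *)
have -> : (fun z : R * R => fOU_pdf H theta z.1 z.2) = (fun z =>
   (Num.sqrt (2 * pi * fOU_var H theta z.1)) `^ (-1) *
     expR (- (z.2 ^+ 2 * (2 * fOU_var H theta z.1) `^ (-1)))).
  apply/funext => z; rewrite powR_inv1 ?sqrtr_ge0// powR_inv1//. apply: mulr_ge0 => //; exact: V0.
apply: measurable_funM.
  apply: (@measurableT_comp _ _ _ _ _ _ (fun a : R => a `^ (-1))); first exact: measurable_powR.
  apply: (measurableT_comp (continuous_measurable_fun (@sqrt_continuous R))).
  exact: measurable_funM.
apply: measurableT_comp => //; apply: measurableT_comp => //.
apply: measurable_funM; first by apply: measurable_funX.
apply: (@measurableT_comp _ _ _ _ _ _ (fun a : R => a `^ (-1))); first exact: measurable_powR.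
exact: measurable_funM.
Qed.

Variable f : R -> R.
Hypotheses (mf : measurable_fun setT f) (f0 : forall y, 0 <= f y).

(** Extended-valued, so that Tonelli's theorem applies before finiteness is known. *)
Definition fOU_mixture (x : R) : \bar R :=
  (\int[mu]_(y in `]0%R, +oo[) (fOU_pdf H theta y x * f y)%:E)%E.

Let mray : measurable (`]0%R, +oo[ : set R). Proof. exact: measurable_itv. Qed.

Lemma fOU_mixture_ge0 x : (0 <= fOU_mixture x)%E.
Proof. by apply: integral_ge0 => y _; rewrite lee_fin mulr_ge0 ?fOU_pdf_ge0. Qed.

Lemma measurable_fOU_mixture : measurable_fun setT fOU_mixture.
Proof.
apply: (@measurable_integral_section R _ (fun z => fOU_pdf H theta z.2 z.1 * f z.2)) => //.
- apply: measurable_funM.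
    apply: (@measurableT_comp _ _ _ _ _ _ (fun z : R * R => fOU_pdf H theta z.1 z.2) _
      (fun z : R * R => (z.2, z.1))); first exact: measurable_fOU_pdf.
    exact: measurable_fun_pair.
  exact: (measurableT_comp mf).
- by move=> z; rewrite mulr_ge0 ?fOU_pdf_ge0.
Qed.

Lemma fOU_mixture_fubini phi : measurable_fun setT phi -> (forall x, 0 <= phi x) ->
  (\int[mu]_(y in `]0%R, +oo[)
     ((\int[mu]_x (phi x * fOU_pdf H theta y x)%:E) * (f y)%:E) =
   \int[mu]_x ((phi x)%:E * fOU_mixture x))%E.
Proof.
move=> mphi phi0.
pose h (z : R * R) : R := phi z.2 * (fOU_pdf H theta z.1 z.2 * f z.1).
have mh : measurable_fun setT h.
  apply: measurable_funM; first exact: (measurableT_comp mphi).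
  by apply: measurable_funM; [exact: measurable_fOU_pdf|exact: (measurableT_comp mf)].
have h0 z : 0 <= h z by rewrite mulr_ge0// mulr_ge0 ?fOU_pdf_ge0.
have e1 := integral_rectangle1 mray (@measurableT _ R) mh h0.
have e2 := integral_rectangle2 mray (@measurableT _ R) mh h0.
have mpdf y : measurable_fun setT (fOU_pdf H theta y).
  exact: (measurableT_comp measurable_fOU_pdf (measurable_pair1 y)).
have mpdf2 x : measurable_fun setT (fun y => fOU_pdf H theta y x * f y).
  by apply: measurable_funM => //; exact: (measurableT_comp measurable_fOU_pdf (measurable_pair2 x)).
transitivity (\int[mu]_(y in `]0%R, +oo[) \int[mu]_(x in setT) (h (y, x))%:E)%E.
  apply: eq_integral => y _; rewrite muleC.
  have k0 x : [set: R] x -> (0 <= (phi x * fOU_pdf H theta y x)%:E)%E.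
    by rewrite lee_fin mulr_ge0 ?fOU_pdf_ge0.
  have mk : measurable_fun setT (fun x => (phi x * fOU_pdf H theta y x)%:E).
    by apply/measurable_EFinP; exact: (measurable_funM mphi (mpdf y)).
  apply: etrans; first exact/esym/(ge0_integralZl_EFin mu measurableT k0 mk (f0 y)).
  by apply: eq_integral => x _; rewrite -EFinM /h/=; congr EFin; ring.
rewrite -e1 e2; apply: eq_integral => x _.
have k0 (y : R) : (`]0%R, +oo[%classic : set R) y -> (0 <= (fOU_pdf H theta y x * f y)%:E)%E.
  by rewrite lee_fin mulr_ge0 ?fOU_pdf_ge0.
have mk : measurable_fun (`]0%R, +oo[%classic : set R) (fun y => (fOU_pdf H theta y x * f y)%:E).
  by apply/measurable_EFinP; exact: (measurable_funTS (mpdf2 x)).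
apply: etrans; last exact: (ge0_integralZl_EFin mu mray k0 mk (phi0 x)).
by apply: eq_integral => y _; rewrite -EFinM.
Qed.

End fOU_mixture.

Section fOU_mixture_of_time.
Context d (T : measurableType d) (R : realType) (P : probability T R).
Notation mu := (@lebesgue_measure R).
Variables (H theta : R) (E : T -> R) (f : R -> R).
Hypotheses (H_gt : 1 / 2 < H) (theta_gt0 : 0 < theta).
Hypotheses (Ef : has_density P E f) (E_ge0 : forall w, 0 <= E w).

(** The bound C (y^(-H) + 1) on the Gaussian density, integrated against the density of E, is C
    times the moment of order -H plus 1. *)
Lemma fOU_mixture_fin x : ('E_P[fun w => (E w `^ (- H))%R] < +oo)%E ->
  fOU_mixture H theta f x \is a fin_num.
Proof.
move=> EH; have [mE mf f0 _] := Ef.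
rewrite ge0_fin_numE; last exact: fOU_mixture_ge0.
have mray : measurable (`]0%R, +oo[ : set R) by exact: measurable_itv.
have [C C0 hC] := fOU_pdf_ub H_gt theta_gt0.
have mb : measurable_fun setT (fun y : R => (C * (y `^ (- H) + 1))%:E).
  apply/measurable_EFinP; apply: measurable_funM => //.
  by apply: measurable_funD => //; exact: measurable_powR.
have b0 (y : R) : (0 <= (C * (y `^ (- H) + 1))%:E)%E.
  by rewrite lee_fin mulr_ge0// addr_ge0// powR_ge0.
apply: (@le_lt_trans _ _ (\int[mu]_y ((C * (y `^ (- H) + 1))%:E * (f y)%:E))%E).
  rewrite /fOU_mixture integral_mkcond; apply: ge0_le_integral => //.
  - move=> y _; rewrite patchE; case: ifPn => // _.
    by rewrite lee_fin mulr_ge0 ?fOU_pdf_ge0.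
  - apply/(measurable_restrictT _ mray); apply/measurable_EFinP.
    apply: measurable_funTS; apply: measurable_funM => //.
    exact: (measurableT_comp (measurable_fOU_pdf H_gt theta_gt0) (measurable_pair2 x)).
  - by apply: emeasurable_funM => //; apply/measurable_EFinP.
  move=> y _; rewrite patchE; case: ifPn => [|_]; last by rewrite mule_ge0// lee_fin.
  by rewrite inE/= in_itv/= andbT => y0; rewrite -EFinM lee_fin ler_wpM2r// hC.
rewrite -(ge0_integral_has_density Ef mb b0).
have mEH : measurable_fun setT (fun w => E w `^ (- H)).
  by apply: (@measurableT_comp _ _ _ _ _ _ (fun a : R => a `^ (- H))) => //; exact: measurable_powR.
under eq_integral do rewrite EFinM.
rewrite ge0_integralZl_EFin//; last 2 first.
- by move=> w _; rewrite lee_fin addr_ge0// powR_ge0.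
- by apply/measurable_EFinP; exact: measurable_funD.
under eq_integral do rewrite EFinD.
rewrite ge0_integralD//; last 2 first.
- by move=> w _; rewrite lee_fin powR_ge0.
- exact/measurable_EFinP.
have -> : (\int[P]_x 1 = 1)%E by rewrite -[RHS](expectation_cst P 1) unlock.
move: EH; rewrite unlock => EH.
apply: lte_mul_pinfty; rewrite ?lee_fin//.
by rewrite lte_add_pinfty ?ltry.
Qed.

(** A law with a density gives no mass to the point 0, and E is nonnegative everywhere. *)
Let pos_ae : {ae P, forall w, 0 < E w}.
Proof.
have [mE mf f0 EfE] := Ef.
exists (E @^-1` [set 0]); split.
- by rewrite -[X in measurable X]setTI; exact: mE.
- by rewrite EfE// integral_set1.
- move=> w /= h; apply/eqP; rewrite eq_le E_ge0 andbT leNgt; exact/negP.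
Qed.

(** V(0) = 0, so the Gaussian formula is available at positive times only. Since E > 0 almost
    surely, K may be set to 0 off the open ray before its integral is rewritten with the density of
    E. *)
Lemma integral_pos_time (I : T -> \bar R) (K : R -> \bar R) :
  measurable_fun setT I -> (forall w, 0 <= I w)%E ->
  measurable_fun setT K -> (forall y, 0 <= K y)%E ->
  (forall w, 0 < E w -> I w = K (E w)) ->
  (\int[P]_w I w = \int[mu]_(y in `]0%R, +oo[) (K y * (f y)%:E))%E.
Proof.
move=> mI I0 mK K0 IK; have [mE mf f0 EfE] := Ef.
have mray : measurable (`]0%R, +oo[ : set R) by exact: measurable_itv.
have mK' : measurable_fun setT (K \_ (`]0%R, +oo[%classic : set R)).
  by apply/(measurable_restrictT _ mray); exact: measurable_funTS.
have K0' y : (0 <= (K \_ (`]0%R, +oo[%classic : set R)) y)%E by exact: erestrict_ge0.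
transitivity (\int[P]_w (K \_ (`]0%R, +oo[%classic : set R)) (E w))%E.
  apply: ge0_ae_eq_integral => //.
  - exact: (measurableT_comp mK').
  - apply: filterS pos_ae => w Ew _.
    by rewrite patchE mem_set ?IK//= in_itv/= Ew.
rewrite (ge0_integral_has_density Ef mK' K0').
rewrite [RHS]integral_mkcond; apply: eq_integral => y _.
by rewrite !patchE; case: ifPn => // _; rewrite mul0e.
Qed.

End fOU_mixture_of_time.

Theorem proposition4p1
  (d : measure_display) (T : measurableType d) (R : realType)
  (P : probability T R) (P_complete : measure_is_complete P)
  (H theta : R) (H_gt : 1 / 2 < H) (H_lt : H < 1) (theta_gt0 : 0 < theta)
  (B : R -> T -> R) (B_fBm : is_fBm P H B)
  (U : R -> T -> R) (U_fOU : is_fOU P H theta B U)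
  (nu : {measure set (measurableTypeR R) -> \bar R})
  (nu_levy : is_levy_measure nu)
  (sigma : R -> T -> R) (sigma_sub : is_subordinator P nu sigma)
  (E_indep : independent_processes P (inverse_subordinator sigma) U)
  (fE : R -> R -> R)
  (fE_density : forall t : R, 0 < t ->
     has_density P (inverse_subordinator sigma t) (fE t))
  (E_moment : forall t : R, 0 < t ->
     ('E_P[fun w => (inverse_subordinator sigma t w `^ (- H))%R] < +oo)%E) :
  exists p : R -> R -> R, forall t : R, 0 < t ->
    has_density P (time_change U (inverse_subordinator sigma) t) (p t) /\
    forall x : R,
      (p t x)%:E =
      (\int[lebesgue_measure]_(y in `]0%R, +oo[)
         (fOU_pdf H theta y x * fE t y)%:E)%E.
Proof.
exists (fun t x => fine (fOU_mixture H theta (fE t) x)) => t t0.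
set E := inverse_subordinator sigma t.
have Ef : has_density P E (fE t) := fE_density t t0.
have [mE mf f0 _] := Ef.
have E_ge0 w : 0 <= E w by exact: inverse_subordinator_ge0.
have mix_fin x : fOU_mixture H theta (fE t) x \is a fin_num.
  by apply: (fOU_mixture_fin H_gt theta_gt0 Ef); exact: E_moment.
split; last by move=> x; rewrite fineK.
have mU y : 0 <= y -> measurable_fun setT (U y) by exact: (fOU_measurable U_fOU).
have U_cont := fOU_continuous U_fOU.
have indep y (A C : set R) : 0 <= y -> measurable A -> measurable C ->
    P (E @^-1` A `&` U y @^-1` C) = (P (E @^-1` A) * P (U y @^-1` C))%E.
  (* Events that concern a single time are among the generators of the two sigma-algebras. *)
  move=> y0 mA mC; apply: E_indep; apply: sub_sigma_algebra.
    by exists t, A; split => //; exact: ltW.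
  by exists y, C.
apply: has_density_of_lipschitz.
- exact: (measurable_random_time P_complete mE E_ge0 mU U_cont).
- apply: (measurableT_comp (@fine_measurable R setT measurableT)).
  exact: measurable_fOU_mixture.
- by move=> x; rewrite fine_ge0// fOU_mixture_ge0.
move=> phi L phi01 phiL.
have phi0 x : 0 <= phi x by case/andP: (phi01 x).
have mphi : measurable_fun setT phi.
  exact: continuous_measurable_fun (lipschitz_continuous_fun phiL).
rewrite (random_time_expectation P_complete mE E_ge0 mU U_cont indep phi01 phiL).
(* The mean of phi under N(0, V(y)); for y > 0 it is the expectation of phi(U(y)) by
   [fOU_expectation], and [fOU_mixture_fubini] will exchange the integrals in y and x. *)
pose K y := (\int[lebesgue_measure]_x (phi x * fOU_pdf H theta y x)%:E)%E.
have K0 y : (0 <= K y)%E.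
  by apply: integral_ge0 => x _; rewrite lee_fin mulr_ge0 ?fOU_pdf_ge0.
have mK : measurable_fun setT K.
  apply: (@measurable_integral_section R setT (fun z => phi z.2 * fOU_pdf H theta z.1 z.2)) => //.
    apply: measurable_funM; first exact: (measurableT_comp mphi).
    exact: measurable_fOU_pdf.
  by move=> z; rewrite mulr_ge0 ?fOU_pdf_ge0.
have mI := measurable_random_time_mean mE E_ge0 mU U_cont phi01 phiL.
rewrite (integral_pos_time Ef E_ge0 mI _ mK K0).
- rewrite fOU_mixture_fubini//.
  by apply: eq_integral => x _; rewrite EFinM fineK.
- by move=> w; apply: integral_ge0 => v _; rewrite lee_fin.
- by move=> w Ew; rewrite (fOU_expectation H_gt H_lt theta_gt0 B_fBm U_fOU Ew phi01 phiL).
Qed.
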